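(* Let $k\ge 2$ and let $M\in\mathcal{W}_k^{\ast}(d)$, i.e. $M\in\mathcal{W}_k(d)$ is $(k+1)$-neighbourly. Then: (a) if $d\ne 2k+1$, then $M$ is tight, that is, $\mathbb{F}$-tight for every field $\mathbb{F}$; and (b) if $d=2k+1$ and $\mathbb{F}$ is a field, then $M$ is $\mathbb{F}$-tight if and only if $\beta_k(M;\mathbb{F})=\binom{n-k-3}{k+1}\Big/\binom{2k+3}{k+1}$, where $n=f_0(M)$ is the number of vertices of $M$.
   Context: All simplicial complexes are finite and abstract, with the empty set as a face. For a finite set $\alpha$, $\overline{\alpha}$ is the complex of all subsets of $\alpha$ and $\partial\alpha$ the complex of all proper subsets. The join $X\ast Y$ (disjoint vertex sets) has as faces the disjoint unions of a face of $X$ and a face of $Y$. The standard sphere $S^d_{d+2}$ is $\partial\alpha$ with $\#\alpha=d+2$. Complexes are identified up to isomorphism. Bistellar moves: if $X$ is $d$-dimensional and $\alpha,\beta$ are disjoint nonempty sets with $\dim\alpha+\dim\beta=d$ (where $\dim\alpha=\#\alpha-1$) such that the set of faces of $X$ contained in $\alpha\sqcup\beta$ is exactly $\overline{\alpha}\ast\partial\beta$, then $Y=(X\setminus(\overline\alpha\ast\partial\beta))\cup(\partial\alpha\ast\overline\beta)$ is obtained from $X$ by the bistellar move $\alpha\mapsto\beta$, of index $\dim\beta$ (if $\beta$ is a single vertex, it is a new vertex). For $0\le k\le d+1$, a $d$-dimensional complex is $k$-stellated if it is obtained from $S^d_{d+2}$ by a finite sequence of bistellar moves, each of index $<k$ ($S^d_{d+2}$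 is the only $0$-stellated one). The link of a vertex $x$ in $X$ is $\{\alpha\in X: x\notin\alpha,\ \alpha\sqcup\{x\}\in X\}$. For $0\le k\le d$, $\mathcal{W}_k(d)$ is the class of connected $d$-dimensional simplicial complexes all of whose vertex links are $k$-stellated $(d-1)$-spheres. $X$ is $l$-neighbourly if any $l$ vertices of $X$ form a face, i.e. $f_i(X)=\binom{f_0(X)}{i+1}$ for all $i\le l-1$, where $f_i$ is the number of $i$-faces. For a field $\mathbb{F}$, a $d$-dimensional complex $X$ is $\mathbb{F}$-tight if it is connected and, for every induced subcomplex $Y$ of $X$ (all faces of $X$ contained in some vertex subset) and every $0\le j\le d$, the morphism $H_j(Y;\mathbb{F})\to H_j(X;\mathbb{F})$ induced by inclusion is injective. $\beta_k(M;\mathbb{F})=\dim_{\mathbb{F}}H_k(M;\mathbb{F})$. *)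

(* Defs.v *)
From HB Require Import structures.
From mathcomp Require Import all_boot all_order all_algebra finmap.

Set Implicit Arguments.
Unset Strict Implicit.
Unset Printing Implicit Defensive.

Import GRing.Theory.

Local Open Scope fset_scope.

(* A finite family of finite sets of natural numbers.  Every finite abstract
   simplicial complex is isomorphic to one with vertices in nat, and nat always
   has room for the new vertices created by bistellar moves. *)
Notation cplx := {fset {fset nat}}.

Definition is_complex (X : cplx) : Prop :=
  fset0 \in X /\ forall s t : {fset nat}, s \in X -> t `<=` s -> t \in X.

Definition vertices (X : cplx) : {fset nat} := fcover X.

(* The i-dimensional faces; the empty face has dimension -1. *)
Definition faces (X : cplx) (i : nat) : cplx := [fset s in X | #|` s| == i.+1].

Definition fvec (X : cplx) (i : nat) : nat := #|` faces X i|.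

Definition has_dim (d : nat) (X : cplx) : Prop :=
  (forall s, s \in X -> #|` s| <= d.+1) /\ exists2 s, s \in X & #|` s| = d.+1.

Definition simplex (a : {fset nat}) : cplx := fpowerset a.

Definition bdry (a : {fset nat}) : cplx := fpowerset a `\ a.

Definition join (X Y : cplx) : cplx :=
  [fset x `|` y | x : {fset nat} in X, y : {fset nat} in Y].

Definition link (X : cplx) (x : nat) : cplx :=
  [fset a in X | (x \notin a) && (x |` a \in X)].

Definition induced (X : cplx) (A : {fset nat}) : cplx :=
  [fset s in X | s `<=` A].

(* When b is a single vertex, [bdry b] is reduced to the empty face, and the
   condition on [induced X (a `|` b)] says that this vertex is not in X. *)
Definition bistellar (d : nat) (a b : {fset nat}) (X Y : cplx) : Prop :=
  [/\ has_dim d X,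
      [/\ a != fset0, b != fset0 & [disjoint a & b]],
      (#|` a|.-1 + #|` b|.-1)%N = d,
      induced X (a `|` b) = join (simplex a) (bdry b)
    & Y = (X `\` join (simplex a) (bdry b)) `|` join (bdry a) (simplex b)].

(* The class is closed under isomorphism: the first constructor takes any a,
   the second any new vertices, and an injection between finite subsets of nat
   extends to a permutation of nat. *)
Inductive stellated (k d : nat) : cplx -> Prop :=
| stellated_sphere (a : {fset nat}) :
    #|` a| = d.+2 -> stellated k d (bdry a)
| stellated_move (X Y : cplx) (a b : {fset nat}) :
    stellated k d X -> bistellar d a b X Y -> #|` b|.-1 < k -> stellated k d Y.

Definition connected (X : cplx) : Prop :=
  vertices X != fset0 /\
  forall x y, x \in vertices X -> y \in vertices X ->
    exists2 p : seq nat,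
      path (fun u v : nat => [fset u; v] \in X) x p & last x p = y.

(* Only meant for 0 < d, since the dimension d - 1 of the links is a nat. *)
Definition classW (k d : nat) (X : cplx) : Prop :=
  [/\ k <= d, is_complex X, has_dim d X, connected X
    & forall x, x \in vertices X -> stellated k d.-1 (link X x)].

(* "At most l" rather than "exactly l" only matters when X has fewer than l
   vertices; it agrees with f_i = binomial(f_0, i+1) for all i < l. *)
Definition neighbourly (l : nat) (X : cplx) : Prop :=
  forall A : {fset nat}, A `<=` vertices X -> #|` A| <= l -> A \in X.

Definition classWstar (k d : nat) (X : cplx) : Prop :=
  classW k d X /\ neighbourly k.+1 X.

Section Homology.
Local Open Scope ring_scope.
Variable F : fieldType.

Definition chain (X : cplx) (j : nat) := {ffun faces X j -> F^o}.

HB.instance Definition _ X j := Vector.on (chain X j).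

(* Faces are oriented by the order of nat: this is the coefficient of t in
   the boundary of s, which is (-1)^i if t is s minus its i-th vertex. *)
Definition incidence (s t : {fset nat}) : F :=
  \sum_(v <- s | s `\ v == t) (-1) ^+ #|` [fset u in s | (u < v)%N]|.

Definition bd_fun (X : cplx) (j : nat) (c : chain X j.+1) : chain X j :=
  [ffun t : faces X j =>
     \sum_(s : faces X j.+1) incidence (fsval s) (fsval t) * c s].

Lemma bd_fun_linear X j : linear (@bd_fun X j).
Proof.
move=> a c c'; apply/ffunP=> t; rewrite !ffunE scaler_sumr -big_split /=.
by apply: eq_bigr => s _; rewrite !ffunE mulrDr /GRing.scale /= mulrCA.
Qed.

HB.instance Definition _ X j := GRing.isLinear.Build F (chain X j.+1)
  (chain X j) _ (@bd_fun X j) (@bd_fun_linear X j).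

Definition bd (X : cplx) (j : nat) : 'Hom(chain X j.+1, chain X j) :=
  linfun (@bd_fun X j).

(* Unreduced: every 0-chain is a cycle. *)
Definition cycles (X : cplx) (j : nat) : {vspace chain X j} :=
  match j return {vspace chain X j} with
  | 0 => fullv
  | i.+1 => lker (bd X i)
  end.

Definition boundaries (X : cplx) (j : nat) : {vspace chain X j} :=
  limg (bd X j).

(* The quotient cycles / boundaries, realized as a complement of the
   boundaries in the cycles; [hclass] is the quotient map on cycles. *)
Definition homology (X : cplx) (j : nat) :=
  subvs_of (cycles X j :\: boundaries X j)%VS.

HB.instance Definition _ X j := Vector.on (homology X j).

Definition hclass (X : cplx) (j : nat) (z : chain X j) : homology X j :=
  vsproj _ (addv_pi1 (cycles X j) (boundaries X j) z).

Definition betti (X : cplx) (j : nat) : nat := \dim {: homology X j}.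

(* Extension by zero; the chain map of the inclusion when Y is in X. *)
Definition incl_chain (Y X : cplx) (j : nat) (c : chain Y j) : chain X j :=
  [ffun s : faces X j => \sum_(t : faces Y j | fsval t == fsval s) c t].

(* The induced map on homology, computed on the representative cycle
   [vsval h] of h; see [hmapE] for independence of the representative. *)
Definition hmap (Y X : cplx) (j : nat) (h : homology Y j) : homology X j :=
  hclass (incl_chain X (vsval h)).

Lemma hclass_eq0 X j (z : chain X j) :
  z \in cycles X j -> (hclass z == 0) = (z \in boundaries X j).
Proof.
move=> Zz; rewrite /hclass.
set P := addv_pi1 _ _ z.
have PD : P \in (cycles X j :\: boundaries X j)%VS by exact: memv_pi.
have e := @addv_pi1_pi2 F _ (cycles X j) (boundaries X j) z
  (subvP (addvSl _ _) z Zz).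
apply/eqP/idP => [/(congr1 val) | Bz].
  by rewrite /= vsprojK // => P0; rewrite -e -/P P0 add0r memv_pi2.
have P0 : P = 0 by apply: (addIr z); rewrite add0r -{2}e addv_pi2_id.
by rewrite P0 linear0.
Qed.

Lemma incl_chain_linear Y X j : linear (@incl_chain Y X j).
Proof.
move=> a c c'; apply/ffunP=> t; rewrite !ffunE scaler_sumr -big_split /=.
by apply: eq_bigr => s _; rewrite !ffunE.
Qed.

HB.instance Definition _ Y X j := GRing.isLinear.Build F (chain Y j)
  (chain X j) _ (@incl_chain Y X j) (@incl_chain_linear Y X j).

Lemma incl_chain_bd (Y X : cplx) j (c : chain Y j.+1) :
  is_complex Y -> Y `<=` X -> incl_chain X (bd Y j c) = bd X j (incl_chain X c).
Proof.
move=> [_ clY] /fsubsetP sYX; rewrite !lfunE /=; apply/ffunP=> t; rewrite !ffunE.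
under eq_bigr do rewrite ffunE.
under [RHS]eq_bigr do rewrite ffunE big_distrr.
rewrite exchange_big [RHS](exchange_big_dep xpredT) //=.
apply: eq_bigr => s _.
have /andP[Ys /eqP cs] : (fsval s \in Y) && (#|` fsval s| == j.+2).
  by have := fsvalP s; rewrite !inE.
have Xs : fsval s \in faces X j.+1 by rewrite !inE /= sYX // cs eqxx.
rewrite [RHS](big_pred1 [` Xs]) => [|s']; last first.
  by rewrite /= eq_sym.
have [Yt|nYt] := boolP (fsval t \in faces Y j).
  by rewrite (big_pred1 [` Yt]).
rewrite big1 => [|t' /eqP et]; last by rewrite -et fsvalP in nYt.
rewrite /incidence /= big1_seq ?mul0r // => v /andP[/eqP st _].
have := fsvalP t; rewrite !inE /= => /andP[_ ct]; move: nYt.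
by rewrite !inE /= ct andbT -st (clY _ _ Ys) // fsubD1set.
Qed.

Lemma hmapE (Y X : cplx) j (z : chain Y j) :
  is_complex Y -> Y `<=` X -> z \in cycles Y j ->
  hmap X (hclass z) = hclass (incl_chain X z).
Proof.
move=> cY sYX Zz; rewrite /hmap /hclass vsprojK; last exact: memv_pi.
set P := addv_pi1 _ _ z.
have e := @addv_pi1_pi2 F _ (cycles Y j) (boundaries Y j) z
  (subvP (addvSl _ _) z Zz).
have /memv_imgP[c _ ec] : addv_pi2 (cycles Y j) (boundaries Y j) z
  \in boundaries Y j by exact: memv_pi2.
rewrite -e -/P ec linearD /= incl_chain_bd // linearD /=.
set b := bd X j _.
have Bb : b \in boundaries X j by rewrite memv_img ?memvf.
suff -> : addv_pi1 (cycles X j) (boundaries X j) b = 0 by rewrite addr0.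
apply: (addIr b); rewrite add0r -{3}(@addv_pi1_pi2 F _ (cycles X j) (boundaries X j) b).
  by rewrite addv_pi2_id.
exact: (subvP (addvSr _ _)).
Qed.

Definition tight (d : nat) (X : cplx) : Prop :=
  connected X /\
  forall (A : {fset nat}) (j : nat), A `<=` vertices X -> (j <= d)%N ->
    injective (@hmap (induced X A) X j).

End Homology.

(* Main.v *)
From HB Require Import structures.
From mathcomp Require Import all_boot all_order all_algebra finmap.
From mathcomp Require Import ring zify.
Require Import Defs.

(* Add the vertices of M one at a time: the relative homology of
   (M[A + x], M[A]) is the reduced homology of L[A], one degree lower, where L
   is the link of x.  For A nonempty and proper the latter lives only in
   dimensions k - 1 and d - k - 1: L is k-neighbourly, which kills the low
   dimensions and, by induction on k through links of links, the high ones;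
   and a bistellar move of index < k changes the homology of an induced
   subcomplex only in dimensions < k or >= d - 1 - k.  So if d <> 2k + 1, then
   in each degree either H(M[A]) vanishes or nothing can be killed.  If
   d = 2k + 1, only degree k matters.  There beta_k(M) is a sum over A, x of
   beta_{k-1}(L[A]) - r(A, x), weighted by the probability that A is the set of
   vertices before x in a random ordering, where r(A, x) >= 0 is the dimension
   of what dies in H_k; M is tight iff all r(A, x) vanish.  The truncated Euler
   characteristic of L[A] changes by a sign under a move exactly when A meets
   the support in b, so the weighted sum of the beta_{k-1}(L[A]) depends only
   on the numbers of moves of each index, which the f-vector determines. *)

Set Implicit Arguments.
Unset Strict Implicit.
Unset Printing Implicit Defensive.

Import Order.TTheory GRing.Theory Num.Theory.

(** * Signs, boundary, cone and contraction on the chains of a full simplex *)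

Section Chains.
Local Open Scope ring_scope.
Variables (F : fieldType) (N : nat).
Local Notation face := {set 'I_N}.
Local Notation chn := {ffun {set 'I_N} -> F^o}.
Implicit Types (u v w x y : 'I_N) (s t a b A : face) (c z : chn).
Implicit Types (i j k : nat) (X Y K L M : {set face}).

(** All chains are functions on the subsets of one set ['I_N], with [N] above every vertex used by M
    and by the moves that build its links. Chain groups of subcomplexes are then subspaces of a
    single space, and injectivity in homology is the inclusion [Inj] between subspaces, with no
    induced map to handle.

    Two substitutes shape the argument. Bistellar moves are combinatorial, so the condition [HS],
    that all links have the homology of spheres, is carried along them; its main use is that a
    nonzero top cycle has full support ([HS_full]). Alexander duality is replaced by growing A to
    the complement of a vertex, which is acyclic, while nothing is killed on the way.

    The constant arises as follows. Let a link have t vertices more than the standard sphere of its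
    dimension 2k, so that n = t + 2k + 3. Neighbourliness forces exactly 'C(t + i - 1, i) moves of
    index i - 1, for 1 <= i <= k. Their alternating sum, weighted by order probabilities, corrected
    for the empty A and summed over x, telescopes to 'C(t + k, k + 1) / 'C(2k + 3, k + 1). *)

Definition sgn v s : F := (-1) ^+ #|[set u in s | (u < v)%N]|.

Lemma sgnK v s : sgn v s * sgn v s = 1.
Proof. by rewrite -expr2 sqrr_sign. Qed.

Lemma sgn_neq0 v s : sgn v s != 0.
Proof. by rewrite signr_eq0. Qed.

Lemma sgnU1 v u s : u \notin s -> sgn v (u |: s) = (-1) ^+ (u < v)%N * sgn v s.
Proof.
move=> us; rewrite /sgn -exprD; congr (_ ^+ _).
rewrite (cardsD1 u) !inE eqxx /=; congr (_ + _)%N.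
apply: eq_card => w; rewrite !inE; case: eqP => //= ->.
by rewrite (negbTE us).
Qed.

Lemma sgnU1id v s : sgn v (v |: s) = sgn v s.
Proof.
rewrite /sgn; congr (_ ^+ _); apply: eq_card => w; rewrite !inE.
by case: eqP => //= ->; rewrite ltnn andbF.
Qed.

Lemma sgn_swap v u s : v != u -> v \notin s -> u \notin s ->
  sgn v s * sgn u (v |: s) = - (sgn u s * sgn v (u |: s)).
Proof.
move=> vu vs us; rewrite !sgnU1 //.
move: (sgn v s) (sgn u s) vu => p q; rewrite -val_eqE /=.
by case: ltngtP => //= _ _; rewrite expr0 expr1; ring.
Qed.

Definition bdf c : chn := [ffun t : face => \sum_(v | v \notin t) sgn v t * c (v |: t)].

Lemma bdf_linear : linear bdf.
Proof.
move=> a c c'; apply/ffunP=> t; rewrite !ffunE scaler_sumr -big_split /=.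
by apply: eq_bigr => s _; rewrite !ffunE mulrDr /GRing.scale /= mulrCA.
Qed.

HB.instance Definition _ := GRing.isLinear.Build F chn chn _ bdf bdf_linear.

Definition D : 'End(chn) := linfun bdf.

Lemma DE c t : D c t = \sum_(v | v \notin t) sgn v t * c (v |: t).
Proof. by rewrite lfunE ffunE. Qed.

(** Terms of [c] that already contain [x] are dropped, and still [D_cone] holds for every chain:
    this is a contracting homotopy of the full simplex. *)
Definition cone x c : chn := [ffun s : face => if x \in s then sgn x s * c (s :\ x) else 0].

(** Reads off the part of [c] on faces through [x] as a chain of the link of [x]. *)
Definition contrf x c : chn := [ffun t : face => if x \in t then 0 else sgn x t * c (x |: t)].

Lemma contrf_linear x : linear (contrf x).
Proof.
move=> a c c'; apply/ffunP=> t; rewrite !ffunE.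
case: ifP => _; first by rewrite scaler0 addr0.
by rewrite mulrDr /GRing.scale /= mulrCA.
Qed.

HB.instance Definition _ x := GRing.isLinear.Build F chn chn _ (contrf x) (contrf_linear x).

Definition contr x : 'End(chn) := linfun (contrf x).

Lemma contrE x c t : contr x c t = if x \in t then 0 else sgn x t * c (x |: t).
Proof. by rewrite lfunE ffunE. Qed.

Lemma contr_eq0 x c s : x \in s -> (contr x c (s :\ x) == 0) = (c s == 0).
Proof.
by move=> xs; rewrite contrE !inE eqxx /= mulf_eq0 (negbTE (sgn_neq0 _ _)) setD1K.
Qed.

Lemma D_cone x c : D (cone x c) = c - cone x (D c).
Proof.
apply/ffunP=> t; rewrite DE !ffunE; case: ifPn => xt; last first.
  rewrite subr0 (bigD1 x) //= ffunE !inE eqxx /= setU1K // sgnU1id mulrA sgnK mul1r.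
  rewrite big1 ?addr0 // => v /andP[vt vx]; rewrite ffunE !inE eq_sym.
  by rewrite (negbTE vx) (negbTE xt) mulr0.
rewrite DE [in RHS](bigD1 x) /=; last by rewrite !inE eqxx.
rewrite setD1K // mulrDr mulrA -[in sgn x t](setD1K xt) sgnU1id sgnK mul1r opprD addNKr.
rewrite mulr_sumr -sumrN; apply: eq_big => [v|v vt].
  by rewrite !inE; case: eqP => [->|] //=; rewrite ?xt ?andbT ?andbF.
have vx : v != x by apply: contraNneq vt => ->.
rewrite ffunE !inE xt orbT !mulrA.
have -> : (v |: t) :\ x = v |: (t :\ x).
  by apply/setP=> w; rewrite !inE; case: (w =P x) => [->|]; rewrite //= eq_sym (negbTE vx).
rewrite -mulNr; congr (_ * _).
have vt' : v \notin t :\ x by rewrite !inE negb_and vt orbT.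
have xt' : x \notin t :\ x by rewrite !inE eqxx.
move: (sgn_swap vx vt' xt'); rewrite -[in sgn v t](setD1K xt) => e.
have -> : sgn x (v |: t) = sgn x (v |: t :\ x).
  rewrite -(sgnU1id x (v |: t :\ x)); congr sgn; apply/setP=> w; rewrite !inE.
  by case: (w =P x) => [->|]; rewrite ?xt ?orbT.
move: e (sgnK v (t :\ x)) (sgnK v (x |: t :\ x)).
move: (sgn v (t :\ x)) (sgn x (v |: t :\ x)) (sgn x (t :\ x)) (sgn v (x |: t :\ x)).
move=> p q r r' e ep er.
rewrite -[LHS]mul1r -ep.
have -> : p * p * (r' * q) = p * r' * (p * q) by ring.
rewrite e; have -> : p * r' * - (r * r') = - r * p * (r' * r') by ring.
by rewrite er mulr1 mulNr.
Qed.

Lemma D_contr x c : D (contr x c) = - contr x (D c).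
Proof.
apply/ffunP=> t; rewrite DE ffunE contrE; case: ifPn => xt.
  by rewrite oppr0 big1 // => v _; rewrite contrE !inE xt orbT mulr0.
rewrite DE mulr_sumr -sumrN [LHS](bigD1 x) //= contrE !inE eqxx mulr0 add0r.
apply: eq_big => [v|v /andP[vt vx]]; first by rewrite !inE negb_or andbC.
rewrite contrE !inE eq_sym (negbTE vx) (negbTE xt) /= !mulrA sgn_swap 1?eq_sym //.
by rewrite mulNr opprK setUCA.
Qed.

(** The vanishing on the diagonal is a separate hypothesis because antisymmetry does not give it in
    characteristic 2. *)
Lemma sum_antisym (f : 'I_N -> 'I_N -> F) :
  (forall v, f v v = 0) -> (forall v w, v != w -> f v w = - f w v) ->
  \sum_v \sum_w f v w = 0.
Proof.
move=> f0 fN.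
have -> : \sum_v \sum_w f v w =
    \sum_(v : 'I_N) \sum_(w : 'I_N | (v < w)%N) f v w +
    \sum_(v : 'I_N) \sum_(w : 'I_N | (w < v)%N) f v w.
  rewrite -big_split; apply: eq_bigr => v _ /=.
  rewrite (bigD1 v) //= f0 add0r (bigID (fun w : 'I_N => (v < w)%N)) /=.
  by congr (_ + _); apply: eq_bigl => w; rewrite -val_eqE /=; case: ltngtP.
rewrite [X in _ + X](exchange_big_dep xpredT) //= -big_split big1 // => v _ /=.
by rewrite -big_split big1 // => w vw /=; rewrite fN ?addNr // -val_eqE /= ltn_eqF.
Qed.

Lemma DD c : D (D c) = 0.
Proof.
apply/ffunP=> t; rewrite DE ffunE.
rewrite big_mkcond -[RHS](@sum_antisym (fun v w => if [&& v \notin t, w \notin t & w != v]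
  then sgn v t * (sgn w (v |: t) * c (w |: (v |: t))) else 0)).
- apply: eq_bigr => v _; case: ifP => vt /=; last by rewrite big1.
  rewrite DE mulr_sumr big_mkcond; apply: eq_bigr => w _.
  by rewrite !inE negb_or andbC.
- by move=> v; rewrite eqxx !andbF.
move=> v w vw; rewrite eq_sym vw !andbT andbC; case: ifP => [/andP[wt vt]|_]; last by rewrite oppr0.
by rewrite !mulrA sgn_swap // mulNr setUCA.
Qed.

Definition restr (P : pred face) c : chn := [ffun s : face => if P s then c s else 0].

Lemma restr_linear P : linear (restr P).
Proof.
move=> a c c'; apply/ffunP=> t; rewrite !ffunE.
by case: ifP => _; rewrite ?scaler0 ?addr0.
Qed.

HB.instance Definition _ P := GRing.isLinear.Build F chn chn _ (restr P) (restr_linear P).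

(* Faces are graded by their cardinality, so the empty face is in degree 0 and
   everything below is reduced homology. *)
Definition C j K : {vspace chn} :=
  limg (linfun (restr (fun s => (s \in K) && (#|s| == j)))).

Lemma memC j K c :
  reflect (forall s, c s != 0 -> s \in K /\ #|s| = j) (c \in C j K).
Proof.
apply: (iffP idP) => [/memv_imgP[c' _ ->] s|H].
  by rewrite lfunE ffunE; case: ifP => [/andP[sK /eqP]|]; rewrite ?eqxx.
suff -> : c = linfun (restr (fun s => (s \in K) && (#|s| == j))) c by rewrite memv_img ?memvf.
apply/ffunP=> s; rewrite lfunE ffunE; case: ifPn => // sN.
by apply/eqP; apply: contraNT sN => /H[-> ->] /=.
Qed.

Definition on K c := forall s, c s != 0 -> s \in K.

Lemma memC_on j K c : c \in C j K -> on K c.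
Proof. by move/memC => H s /H[]. Qed.

Lemma on_memC j K L c : c \in C j K -> on L c -> c \in C j L.
Proof. by move/memC => H Lc; apply/memC=> s /[dup] /H[_ ->] /Lc. Qed.

Lemma onB K c c' : on K c -> on K c' -> on K (c - c').
Proof.
move=> H H' s; rewrite !ffunE; have [c0|/H //] := eqVneq (c s) 0.
by rewrite c0 add0r oppr_eq0 => /H'.
Qed.

Lemma onD K c c' : on K c -> on K c' -> on K (c + c').
Proof.
move=> H H' s; rewrite !ffunE; have [c0|/H //] := eqVneq (c s) 0.
by rewrite c0 add0r => /H'.
Qed.

Lemma CS j K L : K \subset L -> (C j K <= C j L)%VS.
Proof. by move/subsetP=> KL; apply/subvP=> c /memC H; apply/memC=> s /H[/KL]. Qed.

Lemma restr_memC j K c P : c \in C j K -> restr P c \in C j K.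
Proof. by move/memC=> H; apply/memC=> s; rewrite ffunE; case: ifP => _; [move/H|rewrite eqxx]. Qed.

Definition iscplx K := set0 \in K /\ forall s t, s \in K -> t \subset s -> t \in K.

Lemma D_supp c t : D c t != 0 -> exists2 v, v \notin t & c (v |: t) != 0.
Proof.
move=> H; have [v vt|H'] := pickP (fun v => (v \notin t) && (c (v |: t) != 0)).
  by case/andP: vt => vt cv; exists v.
move: H; rewrite DE big1 ?eqxx // => v vt.
by move/(_ v): H'; rewrite vt /= => /negbFE/eqP->; rewrite mulr0.
Qed.

Lemma D_on K c : iscplx K -> on K c -> on K (D c).
Proof.
move=> [_ clK] H t /D_supp[v _ /H] /clK; apply; exact: subsetUr.
Qed.

Lemma D_C j K c : iscplx K -> c \in C j.+1 K -> D c \in C j K.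
Proof.
move=> cK /memC H; apply/memC=> t /D_supp[v vt /H[vK]].
by rewrite cardsU1 vt => -[<-]; split => //; apply: (cK.2 _ _ vK); exact: subsetUr.
Qed.

Lemma cone_C j K x c : c \in C j K -> (forall s, s \in K -> x |: s \in K) ->
  cone x c \in C j.+1 K.
Proof.
move=> /memC H xK; apply/memC=> s; rewrite ffunE; case: ifP => [xs|]; last by rewrite eqxx.
rewrite mulf_eq0 negb_or => /andP[_ /H[sK sj]].
by rewrite (cardsD1 x) xs sj -(setD1K xs); split=> //; apply: xK.
Qed.

Definition Z j K := (C j K :&: lker D)%VS.
Definition B j K := (D @: C j.+1 K)%VS.
(** Reduced Betti number in dimension [j - 1]; for a complex the subtraction is exact by
    [hd_dim]. *)
Definition hd j K := (\dim (Z j K) - \dim (B j K))%N.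

Lemma memZ j K c : (c \in Z j K) = (c \in C j K) && (D c == 0).
Proof. by rewrite memv_cap memv_ker. Qed.

Lemma memB j K z : reflect (exists2 w, w \in C j.+1 K & z = D w) (z \in B j K).
Proof. exact: memv_imgP. Qed.

Lemma subBZ j K : iscplx K -> (B j K <= Z j K)%VS.
Proof.
by move=> cK; apply/subvP=> _ /memB[w Cw ->]; rewrite memZ DD eqxx andbT D_C.
Qed.

Lemma hd_dim j K : iscplx K -> (hd j K + \dim (B j K) = \dim (Z j K))%N.
Proof. by move=> cK; rewrite subnK // dimvS // subBZ. Qed.

Lemma hd0P j K : iscplx K -> hd j K = 0%N -> Z j K = B j K.
Proof.
move=> cK h0; apply/eqP; rewrite eq_sym eqEdim subBZ //= -(hd_dim j cK) h0; exact: leqnn.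
Qed.

Lemma hd0 j K : (Z j K <= B j K)%VS -> hd j K = 0%N.
Proof. by move/dimvS; rewrite -subn_eq0 => /eqP. Qed.

Lemma dimCS j K : (\dim (C j.+1 K) = \dim (Z j.+1 K) + \dim (B j K))%N.
Proof. by rewrite limg_ker_dim. Qed.

Lemma BS j K L : K \subset L -> (B j K <= B j L)%VS.
Proof. by move=> KL; apply: limgS; apply: CS. Qed.

Lemma ZS j K L : K \subset L -> (Z j K <= Z j L)%VS.
Proof. by move=> KL; apply: capvS => //; apply: CS. Qed.

(* Injectivity of the map induced on homology by the inclusion of X in Y. *)
Definition Inj j X Y := (B j Y :&: C j X <= B j X)%VS.

Lemma Inj_refl j X : Inj j X X.
Proof. exact: capvSl. Qed.

Lemma Inj_trans j X Y K : X \subset Y -> Inj j X Y -> Inj j Y K -> Inj j X K.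
Proof.
move=> XY iXY iYK; apply: subv_trans iXY; rewrite subv_cap capvSr andbT.
by apply: subv_trans iYK; apply: capvS => //; apply: CS.
Qed.

Lemma Inj_sub j X Y K : Y \subset K -> Inj j X K -> Inj j X Y.
Proof. by move=> YK; apply: subv_trans; apply: capvS => //; apply: BS. Qed.

Lemma Inj_hd0 j X Y : iscplx X -> hd j X = 0%N -> Inj j X Y.
Proof.
move=> cX /(hd0P cX) e; rewrite /Inj -e; apply/subvP=> z; rewrite memv_cap memZ.
by case/andP=> /memB[w _ ->] ->; rewrite DD eqxx.
Qed.

Lemma hd0_Inj j X Y : iscplx Y -> X \subset Y -> Inj j X Y -> hd j Y = 0%N -> hd j X = 0%N.
Proof.
move=> cY XY iXY /(hd0P cY) e; apply: hd0; apply: subv_trans iXY.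
by rewrite -e subv_cap ZS //= capvSl.
Qed.

End Chains.

(** * Adding cancelling pairs or a single face; truncated Euler characteristics *)

Section Subcomplexes.
Local Open Scope ring_scope.
Variables (F : fieldType) (N : nat).
Local Notation face := {set 'I_N}.
Local Notation chn := {ffun {set 'I_N} -> F^o}.
Local Notation C := (C F).
Local Notation Z := (Z F).
Local Notation B := (B F).
Local Notation hd := (hd F).
Local Notation D := (D F N).
Local Notation Inj := (Inj F).
Implicit Types (u v w x y : 'I_N) (s t a b A W : face) (c z : chn).
Implicit Types (i j k : nat) (X Y K L M : {set face}).

(** A relative cycle is filled modulo X by the cone from [x] over its part outside X, since toggling
    keeps that cone outside X. *)
Lemma toggle_rel X Y x j c : iscplx X -> iscplx Y -> X \subset Y ->
  (forall s, s \in Y :\: X -> x |: s \in Y :\: X /\ s :\ x \in Y :\: X) ->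
  c \in C j Y -> on X (D c) -> exists2 u, u \in C j.+1 Y & c - D u \in C j X.
Proof.
move=> cX cY sXY tog Cc Xc; have CcE := elimT (memC _ _ _) Cc.
set cR := restr (fun s => s \notin X) c.
have RcR s : cR s != 0 -> [/\ c s != 0, s \notin X & s \in Y :\: X].
  rewrite ffunE; case: ifP => [sX c0|]; last by rewrite eqxx.
  by split=> //; rewrite inE sX; case: (CcE _ c0).
exists (cone x cR).
  have: cR \in C j (Y :\: X).
    by apply/memC=> s /RcR[/CcE[_ ->] _ ->].
  by move/(cone_C (x := x)) => /(_ (fun s sR => (tog s sR).1))/(subvP (CS F _ (subsetDl Y X))).
have cXon : on X (c - cR).
  move=> s; rewrite !ffunE; case: ifPn => [|/negPn //]; by rewrite subrr eqxx.
have e : c - D (cone x cR) = (c - cR) + cone x (D cR).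
  by rewrite D_cone opprB addrA [RHS]addrAC.
have DcR : on X (D cR).
  rewrite (_ : cR = c - (c - cR)); last by rewrite opprB addrC subrK.
  rewrite linearB /=; apply: onB => //; exact: D_on.
(* If a face [s] of this cone were outside X, toggling would put [s :\ x] outside X too, but [D cR]
   lives on X. *)
have Xcone : on X (cone x (D cR)).
  move=> s; rewrite ffunE; case: ifP => [xs|]; last by rewrite eqxx.
  rewrite mulf_eq0 negb_or => /andP[_ nz]; have tX := DcR _ nz.
  case/D_supp: nz => v vt /RcR[_ _ vR].
  have sY : s \in Y.
    have := (tog _ vR).1; rewrite inE => /andP[_] /(cY.2) -> //.
    by apply/subsetP => y; rewrite !inE; case: (y == x) => //= ->; rewrite orbT.
  apply: contraT => sX; have := (tog s _).2; rewrite !inE sX sY tX.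
  by move=> /(_ isT).
rewrite e; apply: (on_memC (K := Y)).
  have CcR : cR \in C j Y by apply: restr_memC.
  rewrite -e; apply: rpredB => //; apply: D_C => //.
  have: cR \in C j (Y :\: X).
    by apply/memC=> s /RcR[/CcE[_ ->] _ ->].
  by move/(cone_C (x := x)) => /(_ (fun s sR => (tog s sR).1))/(subvP (CS F _ (subsetDl Y X))).
exact: onD.
Qed.

(* Pairing each new face with the one obtained by toggling x contracts the
   relative chain complex. *)
Lemma toggle_hd X Y x j : iscplx X -> iscplx Y -> X \subset Y ->
  (forall s, s \in Y :\: X -> x |: s \in Y :\: X /\ s :\ x \in Y :\: X) ->
  hd j Y = hd j X.
Proof.
move=> cX cY sXY tog; have rel := toggle_rel cX cY sXY tog.
have eZ : (Z j Y = Z j X + B j Y)%VS.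
  apply/eqP; rewrite eqEsubv; apply/andP; split; last first.
    by rewrite subv_add ZS // subBZ.
  apply/subvP=> c; rewrite memZ => /andP[Cc /eqP Dc].
  have [|u Cu Cd] := rel _ _ Cc; first by move=> s; rewrite Dc ffunE eqxx.
  rewrite -[c](subrK (D u)) memv_add //; last by apply/memB; exists u.
  by rewrite memZ Cd linearB /= DD Dc subrr.
have eB : (B j X = Z j X :&: B j Y)%VS.
  apply/eqP; rewrite eqEsubv; apply/andP; split.
    by rewrite subv_cap subBZ // BS.
  apply/subvP=> z /memv_capP[+ /memB[w Cw ez]]; rewrite memZ ez => /andP[/memC_on Xw _].
  have [u Cu Cd] := rel _ _ Cw Xw.
  apply/memB; exists (w - D u) => //. by rewrite linearB /= DD subr0.
(* Second isomorphism theorem, in dimensions. *)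
have := dimv_sum_cap (Z j X) (B j Y); rewrite -eZ -eB -(hd_dim F j cX) -(hd_dim F j cY).
by rewrite addnAC => /addIn/addIn.
Qed.

(** Toggling an element of [a] preserves the interval from [b] to [a :|: b], so the added faces
    cancel in pairs. *)
Lemma interval_hd X Y a b j : iscplx X -> iscplx Y -> X \subset Y ->
  (forall s, (s \in Y :\: X) = (b \subset s) && (s \subset a :|: b)) ->
  [disjoint a & b] -> a != set0 -> hd j Y = hd j X.
Proof.
move=> cX cY sXY e dab /set0Pn[x xa]; apply: (@toggle_hd X Y x) => // s.
have xb : x \notin b by rewrite (disjointFr dab).
rewrite !e => /andP[/subsetP bs /subsetP st]; split; apply/andP; split; apply/subsetP => y; rewrite !inE.
- by move/bs ->; rewrite orbT.
- by case/orP=> [/eqP->|/st]; rewrite ?xa // inE.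
- by move=> yb; rewrite bs // andbT; apply: contraNneq xb => <-.
- by case/andP=> _ /st; rewrite inE.
Qed.

Section AddFace.
Variables (X : {set face}) (b : face).
Hypotheses (cX : iscplx X) (cY : iscplx (b |: X)) (bX : b \notin X).

Lemma addface_C i : i != #|b| -> C i (b |: X) = C i X.
Proof.
move=> ib; apply/eqP; rewrite eqEsubv [X in _ && X]CS ?subsetUr // andbT.
apply/subvP=> c /memC H; apply/memC=> s /H[]; rewrite !inE => /orP[/eqP->|//] e.
by rewrite e eqxx in ib.
Qed.

Lemma addface_hd i : i != #|b| -> i.+1 != #|b| -> hd i (b |: X) = hd i X.
Proof. by move=> i1 i2; rewrite /hd /Z /B !addface_C. Qed.

Lemma addface_dimC : \dim (C #|b| (b |: X)) = (\dim (C #|b| X)).+1.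
Proof.
pose ev (c : chn) : F^o := c b.
have ev_lin : linear ev by move=> k c c'; rewrite /ev !ffunE.
pose evL : {linear chn -> F^o} := HB.pack ev (GRing.isLinear.Build F chn F^o _ ev ev_lin).
rewrite -(limg_ker_dim (linfun evL) (C #|b| (b |: X))).
have -> : (C #|b| (b |: X) :&: lker (linfun evL))%VS = C #|b| X.
  apply/vspaceP=> c; rewrite memv_cap memv_ker lfunE /= /ev.
  apply/andP/idP=> [[/memC H /eqP c0]|Cc].
    apply/memC=> s cs; have [] := H _ cs; rewrite !inE => /orP[/eqP e|//].
    by rewrite e c0 eqxx in cs.
  split; first by apply: (subvP _ _ Cc); apply: CS; rewrite subsetUr.
  by apply: contraNT bX => /(elimT (memC _ _ _) Cc)[].
rewrite -addn1; congr (_ + _)%N.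
apply/eqP; rewrite eqn_leq; apply/andP; split.
  by rewrite (leq_trans (dimvS (subvf _))) // dimvf.
rewrite lt0n dimv_eq0; apply/eqP => e0.
pose db : chn := [ffun s : face => (s == b)%:R].
have : linfun evL db \in (linfun evL @: C #|b| (b |: X))%VS.
  apply: memv_img; apply/memC=> s; rewrite ffunE.
  by have [->|_] := eqVneq s b; rewrite ?eqxx // !inE eqxx.
rewrite e0 memv0 lfunE /= /ev ffunE eqxx; exact/negP/oner_neq0.
Qed.

End AddFace.

(** With cardinality as degree, the sign is opposite to the usual one; the complex with only the
    empty face gets 1. *)
Definition tchi k K : int := \sum_(j < k.+1) (-1) ^+ j * (hd j K)%:Z.

Lemma Z0 K : Z 0 K = C 0 K.
Proof.
apply/eqP; rewrite eqEsubv capvSl; apply/subvP=> c /[dup] Cc /memC H; rewrite memZ Cc /=.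
apply/eqP/ffunP=> t; rewrite ffunE; apply/eqP; apply: contraT => /D_supp[v vt /H[_ /eqP]].
by rewrite cards_eq0 => /eqP/setP/(_ v); rewrite !inE eqxx.
Qed.

(** Euler-Poincare with one boundary term left over by the truncation. This term depends on the
    faces with [k + 1] elements, hence the gap between [tchi_addface] and [tchi_addface_big]. *)
Lemma tchiE k K : iscplx K ->
  tchi k K = \sum_(j < k.+1) (-1) ^+ j * (\dim (C j K))%:Z - (-1) ^+ k * (\dim (B k K))%:Z.
Proof.
move=> cK; rewrite /tchi; elim: k => [|k IH].
  rewrite !big_ord_recl !big_ord0 /= -Z0 -(hd_dim F 0 cK) PoszD; lia.
rewrite big_ord_recr IH /= [in RHS]big_ord_recr /= dimCS -(hd_dim F k.+1 cK) !PoszD exprS.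
ring.
Qed.

Lemma tchi_addface k X b : iscplx X -> iscplx (b |: X) -> b \notin X -> (#|b| <= k)%N ->
  tchi k (b |: X) = tchi k X + (-1) ^+ #|b|.
Proof.
move=> cX cY bX bk; rewrite !tchiE //.
have -> : B k (b |: X) = B k X by rewrite /B addface_C // gtn_eqF.
rewrite addrAC; congr (_ - _); have bk' : (#|b| < k.+1)%N by [].
rewrite (bigD1 (Ordinal bk')) //= [in RHS](bigD1 (Ordinal bk')) //= addface_dimC //.
rewrite (eq_bigr (fun j : 'I_k.+1 => (-1) ^+ j * (\dim (C j X))%:Z)) => [|j jb].
  rewrite -addn1 PoszD; ring.
by rewrite addface_C.
Qed.

Lemma tchi_addface_big k X b : iscplx X -> iscplx (b |: X) -> (k.+1 < #|b|)%N ->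
  tchi k (b |: X) = tchi k X.
Proof.
move=> cX cY bk; apply: eq_bigr => j _; rewrite addface_hd //.
  by have := ltn_ord j; lia.
by have := ltn_ord j; lia.
Qed.

Lemma cone_hd0 K (A : face) j x : iscplx K -> x \in A -> (forall s, s \in K -> s \subset A) ->
  (forall s, s \subset A -> (#|s| <= j.+1)%N -> s \in K) -> hd j K = 0%N.
Proof.
move=> cK xA KA full; apply: hd0; apply/subvP=> c; rewrite memZ => /andP[/memC Cc /eqP Dc].
apply/memB; exists (cone x c); last first.
  rewrite D_cone Dc [X in _ - X](_ : _ = 0) ?subr0 //.
  by apply/ffunP=> s; rewrite !ffunE mulr0 if_same.
apply/memC=> s; rewrite ffunE; case: ifP => [xs|]; last by rewrite eqxx.
rewrite mulf_eq0 negb_or => /andP[_ /Cc[sK sj]].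
have sj' : #|s| = j.+1 by rewrite (cardsD1 x) xs sj.
split=> //; apply: full; last by rewrite sj'.
by rewrite -(setD1K xs) subUset sub1set xA KA.
Qed.

End Subcomplexes.

(** * The exact sequence of adding one vertex *)

Section VertexAddition.
Local Open Scope ring_scope.
Variables (F : fieldType) (N : nat).
Local Notation face := {set 'I_N}.
Local Notation chn := {ffun {set 'I_N} -> F^o}.
Local Notation C := (C F).
Local Notation Z := (Z F).
Local Notation B := (B F).
Local Notation hd := (hd F).
Local Notation D := (D F N).
Local Notation Inj := (Inj F).
Implicit Types (u v w x y : 'I_N) (s t a b A W : face) (c z : chn).
Implicit Types (i j k : nat) (X Y K L M : {set face}).

Definition ind K A : {set face} := [set s : face in K | s \subset A].
Definition lk K s : {set face} := [set t : face | [disjoint s & t] && (s :|: t \in K)].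

Lemma in_ind K A s : (s \in ind K A) = (s \in K) && (s \subset A).
Proof. by rewrite inE. Qed.

Lemma in_lk K s t : (t \in lk K s) = [disjoint s & t] && (s :|: t \in K).
Proof. by rewrite inE. Qed.

Lemma in_lk1 K x t : (t \in lk K [set x]) = (x \notin t) && (x |: t \in K).
Proof. by rewrite inE disjoints1. Qed.

Lemma iscplx_ind K A : iscplx K -> iscplx (ind K A).
Proof.
move=> [K0 clK]; split; first by rewrite in_ind K0 sub0set.
move=> s t; rewrite !in_ind => /andP[sK sA] ts; rewrite (clK _ _ sK ts) /=.
exact: subset_trans sA.
Qed.

Lemma iscplx_lk K s : iscplx K -> s \in K -> iscplx (lk K s).
Proof.
move=> [K0 clK] sK; split; first by rewrite in_lk setU0 sK -setI_eq0 setI0 eqxx.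
move=> t t'; rewrite !in_lk => /andP[dst stK] tt'; apply/andP; split.
  by rewrite disjoint_sym (disjointWl tt') // disjoint_sym.
by apply: clK stK _; rewrite setUS.
Qed.

Lemma indS K A A' : A \subset A' -> ind K A \subset ind K A'.
Proof.
by move=> AA'; apply/subsetP=> s; rewrite !in_ind => /andP[-> /subset_trans]; apply.
Qed.

Section AddVertex.
Variables (X Y L : {set face}) (x : 'I_N).
Hypotheses (cX : iscplx X) (cY : iscplx Y) (cL : iscplx L).
Hypothesis (LX : L \subset X).
Hypothesis (xX : forall s, s \in X -> x \notin s).
Hypothesis (EY : forall s, (s \in Y) = if x \in s then s :\ x \in L else s \in X).

Lemma addv_sub : X \subset Y.
Proof. by apply/subsetP=> s sX; rewrite EY (negbTE (xX sX)). Qed.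

Lemma addv_contr j c : c \in C j.+1 Y -> contr F x c \in C j L.
Proof.
move=> /memC H; apply/memC=> t; rewrite contrE; case: ifPn => [|xt]; first by rewrite eqxx.
rewrite mulf_eq0 negb_or => /andP[_ /H[]].
rewrite EY !inE eqxx /= setU1K // => tL e; split=> //.
by move: e; rewrite cardsU1 xt => -[].
Qed.

Lemma contr_addv j c : c \in C j Y -> contr F x c = 0 -> c \in C j X.
Proof.
move=> /memC H c0; apply/memC=> s cs; have [] := H s cs; rewrite EY; case: ifP => // xs.
by move: cs; rewrite -(contr_eq0 c xs) c0 ffunE eqxx.
Qed.

Lemma contr_on0 c : on X c -> contr F x c = 0.
Proof.
move=> H; apply/ffunP=> t; rewrite contrE ffunE; case: ifPn => // xt.
have [->|/H/xX] := eqVneq (c (x |: t)) 0; first by rewrite mulr0.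
by rewrite !inE eqxx.
Qed.

Lemma addv_cone j c : c \in C j L -> cone x c \in C j.+1 Y.
Proof.
move=> /memC H; apply/memC=> s; rewrite ffunE; case: ifP => [xs|]; last by rewrite eqxx.
rewrite mulf_eq0 negb_or => /andP[_ /H[sL sj]].
by rewrite EY xs sL (cardsD1 x) xs sj.
Qed.

Lemma contr_cone c : on L c -> contr F x (cone x c) = c.
Proof.
move=> H; apply/ffunP=> t; rewrite contrE; case: ifPn => [xt|xt].
  have [-> //|/H/(subsetP LX)/xX] := eqVneq (c t) 0; by rewrite xt.
by rewrite ffunE !inE eqxx setU1K // mulrA sgnU1id sgnK mul1r.
Qed.

(** What dies comes from the link: if [z] is the boundary of [w], the part of [w] through [x] is a
    cycle of L, and filling it in L pushes [w] off [x]. *)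
Lemma addv_Inj j : hd j L = 0%N -> Inj j X Y.
Proof.
move=> /(hd0P cL) e; apply/subvP=> z /memv_capP[/memB[w Cw ez] /memC_on Xz].
have : contr F x w \in Z j L.
  by rewrite memZ addv_contr // D_contr -ez contr_on0 // oppr0 eqxx.
rewrite e => /memB[u Cu eu].
apply/memB; exists (w + D (cone x u)); last by rewrite linearD /= DD addr0.
apply: contr_addv; first by rewrite rpredD // D_C // addv_cone.
by rewrite linearD /= eu -[contr _ _ (D _)]opprK -D_contr contr_cone ?subrr //; apply: memC_on Cu.
Qed.

(** Exactness at the homology of Y: a cycle is pushed off [x] by filling its contraction in L, then
    filled in X. *)
Lemma addv_hd0 j : hd j L = 0%N -> hd j.+1 X = 0%N -> hd j.+1 Y = 0%N.
Proof.
move=> /(hd0P cL) eL /(hd0P cX) eX; apply: hd0; apply/subvP=> z.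
rewrite memZ => /andP[Cz /eqP Dz].
have : contr F x z \in Z j L by rewrite memZ addv_contr // D_contr Dz linear0 oppr0 eqxx.
rewrite eL => /memB[u Cu eu].
have : z + D (cone x u) \in Z j.+1 X.
  rewrite memZ linearD /= DD addr0 Dz eqxx andbT.
  apply: contr_addv; first by rewrite rpredD // D_C // addv_cone.
  rewrite linearD /= eu -[contr _ _ (D _)]opprK -D_contr contr_cone ?subrr //.
  exact: memC_on Cu.
rewrite eX => /(subvP (BS F _ addv_sub)) H; rewrite -[z](addrK (D (cone x u))) rpredB //.
by apply/memB; exists (cone x u); rewrite ?addv_cone.
Qed.

Lemma addv_dimB j : (\dim (B j.+1 Y) = \dim (B j L) + \dim (B j.+1 Y :&: C j.+1 X))%N.
Proof.
rewrite -(limg_ker_dim (contr F x) (B j.+1 Y)) addnC; congr (_ + _)%N; apply: (congr1 (@dimv _ _)).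
  apply/vspaceP=> z; apply/memv_imgP/memB => [[_ /memB[w Cw ->] ->]|[u Cu ->]].
    by exists (- contr F x w); rewrite ?rpredN ?addv_contr // linearN /= D_contr opprK.
  exists (D (- cone x u)); first by apply/memB; exists (- cone x u); rewrite ?rpredN ?addv_cone.
  rewrite linearN linearN /= -D_contr contr_cone //; exact: memC_on Cu.
apply/vspaceP=> z; rewrite !memv_cap memv_ker.
have [Bz|//] := boolP (z \in B _ _); apply/eqP/idP => /= [|/memC_on/contr_on0 //].
by apply: contr_addv; have := subvP (subBZ F _ cY) _ Bz; rewrite memZ => /andP[].
Qed.

Lemma addv_dimC j : (\dim (C j.+1 Y) = \dim (C j L) + \dim (C j.+1 X))%N.
Proof.
rewrite -(limg_ker_dim (contr F x) (C j.+1 Y)) addnC; congr (_ + _)%N; apply: (congr1 (@dimv _ _)).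
  apply/vspaceP=> z; apply/memv_imgP/idP => [[w Cw ->]|Cz]; first exact: addv_contr.
  by exists (cone x z); rewrite ?addv_cone ?contr_cone //; apply: memC_on Cz.
apply/vspaceP=> z; rewrite !memv_cap memv_ker; apply/andP/idP.
  by case=> Cz /eqP; apply: contr_addv.
move=> Cz; rewrite (contr_on0 (memC_on Cz)) eqxx; split=> //.
by apply: (subvP (CS F _ addv_sub)).
Qed.

(* The dimension of the kernel of the map induced on homology in degree j. *)
Definition killed j X Y := (\dim (B j Y :&: C j X) - \dim (B j X))%N.

Lemma subB_cap j : (B j X <= B j Y :&: C j X)%VS.
Proof.
rewrite subv_cap BS ?addv_sub //=; apply: subv_trans (subBZ F j cX) _; exact: capvSl.
Qed.

Lemma killed_eq0 j : (killed j X Y == 0%N) = Inj j X Y.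
Proof.
rewrite /killed subn_eq0 /Inj.
apply/idP/idP => [H|/dimvS //].
have : (B j X == B j Y :&: C j X)%VS by rewrite eqEdim subB_cap.
by move/eqP=> <-.
Qed.

(** Dimension count in the exact sequence H_{j+2}(X) -> H_{j+2}(Y) -> H_{j+1}(L) -> H_{j+1}(X),
    whose last term vanishes by assumption. *)
Lemma addv_hd j : hd j.+1 X = 0%N ->
  (hd j.+2 Y + killed j.+2 X Y = hd j.+2 X + hd j.+1 L)%N.
Proof.
move=> h0; have iX := Inj_hd0 Y cX h0.
have e1 : \dim (B j.+1 Y :&: C j.+1 X)%VS = \dim (B j.+1 X).
  by apply/eqP; rewrite eqn_leq !dimvS // subB_cap.
have e2 := dimvS (subB_cap j.+2).
have := addv_dimB j; have := addv_dimB j.+1; have := addv_dimC j.+1.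
rewrite !dimCS e1 -!(hd_dim F) // /killed.
move: (\dim (_ :&: _)%VS) (\dim (B j.+2 Y)) (\dim (B j.+2 X)) (\dim (B j.+1 Y)) e2.
move: (\dim (B j.+1 X)) (\dim (B j.+1 L)) (\dim (B j L)) (hd j.+2 Y) (hd j.+2 X) (hd j.+1 L).
by move=> *; lia.
Qed.

End AddVertex.

Section AddVertexInd.
Variables (M : {set face}) (x : 'I_N) (A : face).
Hypotheses (cM : iscplx M) (xM : [set x] \in M) (xA : x \notin A).
Let X := ind M A.
Let Y := ind M (x |: A).
Let L := ind (lk M [set x]) A.

Let cX : iscplx X. Proof. exact: iscplx_ind. Qed.
Let cY : iscplx Y. Proof. exact: iscplx_ind. Qed.
Let cL : iscplx L. Proof. by apply/iscplx_ind/iscplx_lk. Qed.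

Let LX : L \subset X.
Proof.
apply/subsetP=> s; rewrite !in_ind in_lk1 => /andP[/andP[_ sM] ->]; rewrite andbT.
by apply: (cM.2 _ _ sM); apply: subsetUr.
Qed.

Let xX s : s \in X -> x \notin s.
Proof. by rewrite in_ind => /andP[_ /subsetP sA]; apply: contra xA => /sA. Qed.

Let EY s : (s \in Y) = if x \in s then s :\ x \in L else s \in X.
Proof.
rewrite !in_ind; case: ifPn => xs; last first.
  congr (_ && _); apply/idP/idP=> [/subsetP sA|/subset_trans]; last by apply; apply: subsetUr.
  by apply/subsetP=> y ys; have := sA y ys; rewrite !inE; case: eqP => // e; rewrite -e ys in xs.
rewrite in_lk1 !inE eqxx /= setD1K //; congr (_ && _).
by rewrite subDset.
Qed.

Lemma ind_addv_Inj j : hd j L = 0%N -> Inj j X Y.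
Proof. exact: addv_Inj cY cL LX xX EY j. Qed.

Lemma ind_addv_hd0 j : hd j L = 0%N -> hd j.+1 X = 0%N -> hd j.+1 Y = 0%N.
Proof. exact: (addv_hd0 cX cY cL LX xX EY). Qed.

Lemma ind_killed_eq0 j : (killed j X Y == 0%N) = Inj j X Y.
Proof. exact: (killed_eq0 cX xX EY j). Qed.

Lemma ind_addv_hd j : hd j.+1 X = 0%N ->
  (hd j.+2 Y + killed j.+2 X Y = hd j.+2 X + hd j.+1 L)%N.
Proof. exact: (addv_hd cX cY cL LX xX EY). Qed.

End AddVertexInd.

Lemma Inj_grow j M A W : A \subset W ->
  (forall A' x, A \subset A' -> x |: A' \subset W -> x \notin A' ->
     Inj j (ind M A') (ind M (x |: A'))) ->
  Inj j (ind M A) (ind M W).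
Proof.
move=> AW H; have [n le_n] := ubnP #|W :\: A|; elim: n A AW H le_n => // n IH A AW H.
have [WA|/subsetPn[x xW xA] le_n] := boolP (W \subset A).
  move=> _; have -> : A = W by apply/eqP; rewrite eqEsubset AW.
  exact: Inj_refl.
apply: (@Inj_trans _ _ _ _ (ind M (x |: A))); first by apply: indS; apply: subsetUr.
  by apply: H => //; rewrite subUset sub1set xW.
apply: IH; first by rewrite subUset sub1set xW.
  by move=> A' y AA'; apply: H; apply: subset_trans AA'; apply: subsetUr.
move: le_n; rewrite (cardsD1 x) !inE xA xW ltnS; apply: leq_ltn_trans.
by apply/subset_leq_card/subsetP=> y; rewrite !inE negb_or => /andP[/andP[-> ->] ->].
Qed.

End VertexAddition.

(** * Complexes whose links are homology spheres; full support of top cycles *)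

Section HomologySpheres.
Local Open Scope ring_scope.
Variables (F : fieldType) (N : nat).
Local Notation face := {set 'I_N}.
Local Notation chn := {ffun {set 'I_N} -> F^o}.
Local Notation C := (C F).
Local Notation Z := (Z F).
Local Notation B := (B F).
Local Notation hd := (hd F).
Local Notation D := (D F N).
Local Notation Inj := (Inj F).
Implicit Types (u v w x y : 'I_N) (s t a b A W : face) (c z : chn).
Implicit Types (i j k : nat) (X Y K L M : {set face}).

Lemma card_disjU s t : [disjoint s & t] -> #|s :|: t| = (#|s| + #|t|)%N.
Proof. by move=> st; rewrite -cardsUI disjoint_setI0 // cards0 addn0. Qed.

Lemma lk_set0 K : lk K set0 = K.
Proof.
by apply/setP=> s; rewrite in_lk set0U -setI_eq0 set0I eqxx.
Qed.

Lemma lk_lk K s t : t \in lk K s -> lk (lk K s) t = lk K (s :|: t).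
Proof.
rewrite in_lk => /andP[st _]; apply/setP=> u.
move: st; rewrite !in_lk setUA -!setI_eq0 setIUl setIUr !setU_eq0 => ->.
by rewrite andbA [(t :&: u == _) && _]andbC.
Qed.

Lemma contr_lk j K x c : c \in C j.+1 K -> contr F x c \in C j (lk K [set x]).
Proof.
move=> /memC H; apply/memC=> t; rewrite contrE; case: ifPn => [|xt]; first by rewrite eqxx.
rewrite mulf_eq0 negb_or => /andP[_ /H[]].
by rewrite in_lk1 cardsU1 xt => -> [].
Qed.

Lemma contr_lkZ j K x c : c \in Z j.+1 K -> contr F x c \in Z j (lk K [set x]).
Proof.
rewrite !memZ => /andP[/contr_lk-> /eqP Dc] /=.
by rewrite D_contr Dc linear0 oppr0.
Qed.

(* All links, including the whole complex, have the homology of a sphere; n is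
   the cardinality of the facets, that is the dimension plus one. *)
Definition HS n K := iscplx K /\
  forall s, s \in K -> (#|s| <= n)%N /\ forall j, hd j (lk K s) = (j == (n - #|s|)%N).

Lemma HS_lk n K s : HS n K -> s \in K -> HS (n - #|s|) (lk K s).
Proof.
move=> [cK H] sK; split=> [|t tL]; first exact: iscplx_lk.
rewrite lk_lk //; move: tL; rewrite in_lk => /andP[st /H[]].
have -> : #|s :|: t| = (#|s| + #|t|)%N by rewrite card_disjU.
move=> le e; split; first by rewrite leq_subRL // (leq_trans _ le) // leq_addr.
by move=> j; rewrite e subnDA.
Qed.

Lemma HS_lk1 n K x : HS n.+1 K -> [set x] \in K -> HS n (lk K [set x]).
Proof. by move=> H /(HS_lk H); rewrite cards1 subSS subn0. Qed.

Lemma HS_hd n K j : HS n K -> hd j K = (j == n).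
Proof. by move=> [[K0 _] /(_ _ K0)[_ /(_ j)]]; rewrite lk_set0 cards0 subn0. Qed.

(** The link of [s] carries a nonzero top cycle, and any face in its support completes [s] to a
    facet. *)
Lemma HS_pure n K s : HS n K -> s \in K -> exists2 s', s' \in K & s \subset s' /\ #|s'| = n.
Proof.
move=> [cK H] sK; have [sn /(_ (n - #|s|)%N)] := H _ sK; rewrite eqxx => h1.
have: Z (n - #|s|) (lk K s) != 0%VS.
  by rewrite -dimv_eq0 -(hd_dim F _ (iscplx_lk cK sK)) h1.
rewrite -vpick0 => nz; have [t zt|z0] := pickP (fun t => vpick (Z (n - #|s|) (lk K s)) t != 0).
  have : vpick (Z (n - #|s|) (lk K s)) \in Z (n - #|s|) (lk K s) by apply: memv_pick.
  rewrite memZ => /andP[/memC/(_ _ zt)[]]; rewrite in_lk => /andP[st stK] e _.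
  exists (s :|: t) => //; split; first exact: subsetUl.
  have -> : #|s :|: t| = (#|s| + #|t|)%N by rewrite card_disjU.
  by rewrite e subnKC.
by case/eqP: nz; apply/ffunP=> t; rewrite ffunE; move/(_ t)/negbFE/eqP: z0.
Qed.

Lemma C_big n j K : (forall s, s \in K -> (#|s| <= n)%N) -> (n < j)%N -> C j K = 0%VS.
Proof.
move=> H nj; apply/eqP; rewrite -subv0; apply/subvP=> c /memC Cc; rewrite memv0.
apply/eqP/ffunP=> s; rewrite ffunE; apply/eqP; apply: contraT => /Cc[/H + e].
by rewrite e leqNgt nj.
Qed.

Definition dl s : chn := [ffun t : face => (t == s)%:R].

Lemma dl_C s K : s \in K -> dl s \in C #|s| K.
Proof.
by move=> sK; apply/memC=> t; rewrite ffunE; have [->|] := eqVneq t s; rewrite ?eqxx.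
Qed.

Lemma D_dl1 x : D (dl [set x]) = dl set0.
Proof.
apply/ffunP=> t; rewrite DE ffunE; have [->|t0] := eqVneq t set0.
  rewrite (bigD1 x) ?inE //= ffunE setU0 eqxx mulr1 big1 ?addr0.
    rewrite /sgn (_ : #|_| = 0%N) //; apply/eqP; rewrite cards_eq0.
    by apply/eqP/setP=> u; rewrite !inE.
  by move=> v /andP[_ vx]; rewrite ffunE setU0 (inj_eq set1_inj) (negbTE vx) mulr0.
rewrite big1 // => v vt; rewrite ffunE; case: eqP => [e|]; last by rewrite mulr0.
have : #|v |: t| = 1%N by rewrite e cards1.
by rewrite cardsU1 vt => -[/eqP]; rewrite cards_eq0 (negbTE t0).
Qed.

(* The vertices whose stars a top cycle avoids are closed under adjacency, and
   the vanishing of homology in dimension 0 says that the complex is connected. *)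
Lemma HS_full n K z s0 : HS n K -> z \in Z n K -> s0 \in K -> #|s0| = n ->
  z s0 = 0 -> z = 0.
Proof.
elim: n K z s0 => [|n IH] K z s0 hK Zz s0K cs0 zs0.
  move: Zz; rewrite memZ => /andP[/memC Cz _]; apply/ffunP=> s; rewrite ffunE.
  apply/eqP; apply: contraT => /[dup] + /Cz[_ /eqP]; rewrite cards_eq0 => + /eqP e.
  by move/eqP: cs0; rewrite cards_eq0 e => /eqP <-; rewrite zs0 eqxx.
have clK := hK.1.2.
have star x s : s \in K -> #|s| = n.+1 -> x \in s -> z s = 0 -> contr F x z = 0.
  move=> sK cs xs zs; have xK : [set x] \in K by apply: clK sK _; rewrite sub1set.
  apply: (IH (lk K [set x]) _ (s :\ x)); rewrite ?contr_lkZ //.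
  - exact: HS_lk1.
  - by rewrite in_lk1 !inE eqxx setD1K.
  - by move: cs; rewrite (cardsD1 x) xs => -[].
  by apply/eqP; rewrite contr_eq0 // zs.
have [/eqP //|z0] := boolP (z == 0).
have Cz : forall s, z s != 0 -> s \in K /\ #|s| = n.+1 by move: Zz; rewrite memZ => /andP[/memC].
have [s1 zs1] : exists s1, z s1 != 0.
  have [s zs|zz] := pickP (fun s => z s != 0); first by exists s.
  by case/eqP: z0; apply/ffunP=> s; rewrite ffunE; move/(_ s)/negbFE/eqP: zz.
have [s1K cs1] := Cz _ zs1.
have /set0Pn[x0 xs0] : s0 != set0 by rewrite -cards_eq0 cs0.
have /set0Pn[x1 xs1] : s1 != set0 by rewrite -cards_eq0 cs1.
have x0K : [set x0] \in K by apply: clK s0K _; rewrite sub1set.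
have x1K : [set x1] \in K by apply: clK s1K _; rewrite sub1set.
have cx0 := star _ _ s0K cs0 xs0 zs0.
have cx1 : contr F x1 z != 0.
  by apply: contraNneq zs1 => c0; rewrite -(contr_eq0 z xs1) c0 ffunE.
have x01 : x0 != x1 by apply: contraNneq cx1 => <-; rewrite cx0.
have Zdl : dl [set x0] - dl [set x1] \in Z 1 K.
  have dlC x : [set x] \in K -> dl [set x] \in C 1 K by move=> /dl_C; rewrite cards1.
  by rewrite memZ linearB /= !D_dl1 subrr eqxx andbT rpredB // dlC.
(* In degree one the cycles form the line spanned by [z], and the difference of the points [x0] and
   [x1] is not on it because [z] vanishes at [x0]. In higher degree this difference bounds a chain
   [w]. *)
have [n0|n0] := posnP n.
  subst n; have e0 : s0 = [set x0].
    by apply/eqP; rewrite eq_sym eqEcard sub1set xs0 cs0 cards1.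
  have B0 : B 1 K = 0%VS.
    by rewrite /B (C_big (n := 1)) ?limg0 // => s /hK.2[].
  have dZ : \dim (Z 1 K) = 1%N by rewrite -(hd_dim F 1 hK.1) B0 dimv0 (HS_hd _ hK).
  have : Z 1 K = <[z]>%VS.
    by apply/eqP; rewrite eq_sym eqEdim -memvE Zz dZ dim_vline z0.
  move=> eZ; move: Zdl; rewrite eZ => /vlineP[k /ffunP/(_ s0)].
  rewrite !ffunE e0 eqxx (inj_eq set1_inj) (negbTE x01) subr0 -e0 zs0 scaler0 => /eqP.
  by rewrite oner_eq0.
move: Zdl; rewrite hd0P; [|exact: hK.1|by rewrite (HS_hd _ hK) eqSS eq_sym (gtn_eqF n0)].
move=> /memB[w Cw ew].
pose U := [set x | contr F x z == 0].
have closed u v : u \in U -> [set u; v] \in K -> v \in U.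
  rewrite !inE => /eqP cu /(HS_pure hK)[s sK [/subsetP uvs cs]].
  have us : u \in s by rewrite uvs // !inE eqxx.
  have vs : v \in s by rewrite uvs // !inE eqxx orbT.
  apply/eqP/(star _ _ sK cs vs); apply/eqP.
  by rewrite -(contr_eq0 z us) cu ffunE.
(* No edge of K leaves [U], so cutting [w] down to [U] commutes with the boundary. The boundary of
   what remains is the single point [x0], against [DD]. *)
have eU : D (restr (fun s => s \subset U) w) = restr (fun s => s \subset U) (D w).
  apply/ffunP=> t; rewrite DE [RHS]ffunE DE.
  case: ifPn => tU.
    apply: eq_bigr => v vt; rewrite ffunE; case: ifPn => // vU.
    have [->//|/(elimT (memC _ _ _) Cw)[vtK]] := eqVneq (w (v |: t)) 0.
    rewrite cardsU1 vt => -[/eqP/cards1P[u eu]]; case/negP: vU.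
    rewrite subUset tU andbT sub1set; apply: (closed u).
      by move: tU; rewrite eu sub1set.
    by move: vtK; rewrite eu setUC.
  rewrite big1 // => v vt; rewrite ffunE ifF ?mulr0 //.
  by apply: contraNF tU => /(subset_trans _)->//; apply: subsetUr.
have : D (dl [set x0]) = 0.
  have -> : dl [set x0] = restr (fun s => s \subset U) (D w).
    apply/ffunP=> t; rewrite -ew !ffunE.
    have [->|t0] := eqVneq t [set x0].
      by rewrite sub1set inE cx0 eqxx (inj_eq set1_inj) (negbTE x01) subr0.
    have [->|t1] := eqVneq t [set x1]; last by rewrite subrr if_same.
    by rewrite sub1set inE (negbTE cx1).
  by rewrite -eU DD.
rewrite D_dl1 => /ffunP/(_ set0)/eqP; by rewrite !ffunE eqxx oner_eq0.
Qed.

End HomologySpheres.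

(** * Boundaries of simplices and their induced subcomplexes *)

Section Spheres.
Local Open Scope ring_scope.
Variables (F : fieldType) (N : nat).
Local Notation face := {set 'I_N}.
Local Notation chn := {ffun {set 'I_N} -> F^o}.
Local Notation C := (C F).
Local Notation Z := (Z F).
Local Notation B := (B F).
Local Notation hd := (hd F).
Local Notation D := (D F N).
Local Notation Inj := (Inj F).
Implicit Types (u v w x y : 'I_N) (s t a b A W : face) (c z : chn).
Implicit Types (i j k : nat) (X Y K L M : {set face}).

Definition sphere a : {set face} := [set s : face | s \proper a].

Lemma in_sphere a s : (s \in sphere a) = (s \proper a).
Proof. by rewrite inE. Qed.

Lemma iscplx_powerset a : iscplx (powerset a).
Proof.
split; first by rewrite inE sub0set.
by move=> s t; rewrite !inE => sa ts; apply: subset_trans sa.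
Qed.

Lemma iscplx_sphere a : a != set0 -> iscplx (sphere a).
Proof.
move=> a0; split; first by rewrite inE proper0.
by move=> s t; rewrite !inE => sa ts; apply: sub_proper_trans sa.
Qed.

Lemma powersetE a : powerset a = a |: sphere a.
Proof. by apply/setP=> s; rewrite !inE subEproper. Qed.

Lemma hd_powerset a j : a != set0 -> hd j (powerset a) = 0%N.
Proof.
case/set0Pn=> x xa; apply: (@cone_hd0 _ _ _ a j x) => //; first exact: iscplx_powerset.
  by move=> s; rewrite inE.
by move=> s; rewrite inE.
Qed.

Lemma hd_empty j : hd j [set set0 : face] = (j == 0%N).
Proof.
have CB i : C i.+1 [set set0 : face] = 0%VS.
  by apply: (C_big F (n := 0)) => // s; rewrite inE => /eqP->; rewrite cards0.
case: j => [|j]; last by rewrite /hd /Z CB cap0v dimv0 sub0n.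
rewrite /hd Z0 /B CB limg0 dimv0 subn0 -[[set set0 : face]]setU0.
rewrite -[in X in \dim X](cards0 'I_N) addface_dimC ?inE // eqxx.
apply/eqP; rewrite eqSS dimv_eq0 -subv0.
apply/subvP=> c /memC Cc; rewrite memv0; apply/eqP/ffunP=> s; rewrite ffunE.
by apply/eqP; apply: contraT => /Cc[]; rewrite inE.
Qed.

(** Removing the top face from the acyclic complex [powerset a] can only change degrees [#|a| - 1]
    and [#|a|]; in the lower one, the cycle bounding that face survives. *)
Lemma hd_sphere a j : a != set0 -> hd j (sphere a) = (j.+1 == #|a|).
Proof.
move=> a0; have a_gt0 : (0 < #|a|)%N by rewrite card_gt0.
have aS : a \notin sphere a by rewrite inE properxx.
have big i : (#|a| <= i)%N -> C i (sphere a) = 0%VS.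
  move=> ai; apply: (C_big F (n := #|a|.-1)); last by rewrite prednK.
  by move=> s; rewrite inE => /proper_card; case: #|a|.
have cP := iscplx_powerset a.
have [e|ne] := eqVneq j.+1 #|a|; last first.
  have [lt|ge] := ltnP j #|a|; last by rewrite /hd /Z big // cap0v dimv0 sub0n.
  have := @addface_hd F _ (sphere a) a j; rewrite -powersetE hd_powerset // => <- //.
  by rewrite ltn_eqF.
have hP i : Z i (powerset a) = B i (powerset a) by apply: hd0P => //; apply: hd_powerset.
have CP : C j.+2 (powerset a) = 0%VS.
  by apply: (C_big F (n := #|a|)); rewrite ?e // => s; rewrite inE => /subset_leq_card.
have eZ : Z j (powerset a) = Z j (sphere a).
  by rewrite /Z powersetE addface_C // -e ltn_eqF.
rewrite /hd -eZ /B big ?e // limg0 dimv0 subn0 hP.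
have := dimCS F j (powerset a); rewrite hP {1}/B CP limg0 dimv0 add0n => <-.
by rewrite powersetE e addface_dimC // big // dimv0.
Qed.

Lemma lk_sphere a s : s \proper a -> lk (sphere a) s = sphere (a :\: s).
Proof.
move=> sa; apply/setP=> t; rewrite in_lk !in_sphere !properE subUset (proper_sub sa) /=.
rewrite subsetD disjoint_sym !subDset; case: (t \subset a) => //=; last by rewrite andbF.
Qed.

Lemma HS_sphere a n : #|a| = n.+1 -> HS F n (sphere a).
Proof.
move=> ca; have a0 : a != set0 by rewrite -cards_eq0 ca.
split=> [|s]; first exact: iscplx_sphere.
rewrite in_sphere => sa; have lt := proper_card sa; rewrite ca ltnS in lt.
split=> // j; rewrite lk_sphere // hd_sphere; last first.
  by case/properP: sa => _ [x xa xs]; apply/set0Pn; exists x; rewrite inE xs.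
have /setIidPr sI := proper_sub sa.
by rewrite cardsD sI ca subSn // eqSS.
Qed.

Lemma ind_sphere a A : ind (sphere a) A = if a \subset A then sphere a else powerset (A :&: a).
Proof.
apply/setP=> s; rewrite in_ind in_sphere; case: ifPn => aA.
  rewrite in_sphere; case sa: (s \proper a) => //=.
  by apply: subset_trans aA; apply: proper_sub.
rewrite inE subsetI [RHS]andbC; case sA: (s \subset A); last by rewrite !andbF.
rewrite !andbT properE; case: (s \subset a) => //=.
by apply: contra aA => /subset_trans; apply.
Qed.

Lemma hd_ind_sphere a A j : (0 < j)%N -> (j.+1 < #|a|)%N -> hd j (ind (sphere a) A) = 0%N.
Proof.
move=> j0 ja; rewrite ind_sphere; case: ifP => _.
  by rewrite hd_sphere ?(ltn_eqF ja) // -card_gt0 (leq_trans _ ja).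
have [->|?] := eqVneq (A :&: a) set0; last exact: hd_powerset.
by rewrite powerset0 hd_empty (gtn_eqF j0).
Qed.

Lemma hd0_ind_sphere a A : (1 < #|a|)%N -> hd 0 (ind (sphere a) A) = (A :&: a == set0).
Proof.
move=> a1; have a0 : a != set0 by rewrite -card_gt0 ltnW.
rewrite ind_sphere; case: ifPn => aA.
  by rewrite hd_sphere // (ltn_eqF a1) (setIidPr aA) (negbTE a0).
have [->|?] := eqVneq (A :&: a) set0; last exact: hd_powerset.
by rewrite powerset0 hd_empty.
Qed.

End Spheres.

(** * From a complex to the trace of a bistellar move *)

Section Moves.
Local Open Scope ring_scope.
Variables (F : fieldType) (N : nat).
Local Notation face := {set 'I_N}.
Local Notation chn := {ffun {set 'I_N} -> F^o}.
Local Notation C := (C F).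
Local Notation Z := (Z F).
Local Notation B := (B F).
Local Notation hd := (hd F).
Local Notation D := (D F N).
Local Notation Inj := (Inj F).
Implicit Types (u v w x y : 'I_N) (s t a b A W : face) (c z : chn).
Implicit Types (i j k : nat) (X Y K L M : {set face}).

(* The trace Y of the move contains the simplex on the union of a and b; going
   from X to the trace adds the interval of faces above b. *)
Section HalfMove.
Variables (X Y : {set face}) (a b : face).
Hypotheses (cX : iscplx X) (cY : iscplx Y).
Hypotheses (a0 : a != set0) (dab : [disjoint a & b]).
Hypothesis (abY : a :|: b \in Y).
Hypothesis (EX : forall s, (s \in X) = (s \in Y) && ~~ ((b \subset s) && (s \subset a :|: b))).

Lemma half_sub : X \subset Y.
Proof. by apply/subsetP=> s; rewrite EX => /andP[]. Qed.

Lemma half_diff s : (s \in Y :\: X) = (b \subset s) && (s \subset a :|: b).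
Proof.
rewrite inE EX; case sY: (s \in Y) => /=; first by rewrite negbK andbT.
by apply/esym/negP=> /andP[_ /(cY.2 _ _ abY)]; rewrite sY.
Qed.

(** Inside [A] the extra faces form the interval from [b] to [(a :&: A) :|: b] and cancel in pairs.
    This fails only if [A] contains [b] and misses [a], the excluded case. *)
Lemma half_ind j A : A :&: (a :|: b) != b -> hd j (ind Y A) = hd j (ind X A).
Proof.
move=> nb; have [bA|bA] := boolP (b \subset A); last first.
  congr (hd _ _); apply/setP=> s; rewrite !in_ind EX; case sA: (s \subset A); rewrite ?andbF // !andbT.
  by case bs: (b \subset s); rewrite ?andbT //; rewrite (subset_trans bs sA) in bA.
have eU : (a :&: A) :|: b = (a :|: b) :&: A by rewrite setIUl (setIidPl bA).
apply: (@interval_hd _ _ _ _ (a :&: A) b).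
- exact: iscplx_ind.
- exact: iscplx_ind.
- by apply/subsetP=> s; rewrite !in_ind => /andP[/(subsetP half_sub)-> ->].
- move=> s; rewrite inE !in_ind negb_and; have := half_diff s; rewrite inE.
  case sA: (s \subset A); rewrite ?orbT ?andbT ?orbF ?andbF /=.
by move=> ->; rewrite eU subsetI sA andbT.
  by move=> _; rewrite eU subsetI sA !andbF.
- by apply: disjointWl dab; apply: subsetIl.
apply: contra nb => /eqP e; rewrite setIUr [A :&: a]setIC e set0U.
by apply/eqP/setIidPr.
Qed.

Lemma half_ind_face A : A :&: (a :|: b) = b -> ind Y A = b |: ind X A /\ b \notin ind X A.
Proof.
move=> e; have bA : b \subset A by rewrite -e subsetIl.
have bY : b \in Y by apply: cY.2 abY _; apply: subsetUr.
split; last by rewrite in_ind EX subxx subsetUr andbF.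
apply/setP=> s; rewrite !inE EX; have [->|sb] := eqVneq s b; first by rewrite bY bA.
case sA: (s \subset A); rewrite ?andbF // !andbT /=.
suff -> : (b \subset s) && (s \subset a :|: b) = false by rewrite andbT.
apply: contraNF sb => /andP[bs st]; rewrite eqEsubset bs andbT -e subsetI sA.
exact: st.
Qed.

Lemma half_lk j s : s \in X -> s \subset a :|: b -> ~~ (a \subset s) ->
  hd j (lk Y s) = hd j (lk X s).
Proof.
move=> sX st nas; have sY := subsetP half_sub _ sX.
apply: (@interval_hd _ _ _ _ (a :\: s) (b :\: s)).
- exact: iscplx_lk.
- exact: iscplx_lk.
- by apply/subsetP=> t; rewrite !in_lk => /andP[-> /(subsetP half_sub)].
- move=> t; have := half_diff (s :|: t); rewrite !inE => e.
  rewrite -setDUl !subDset subsetD subUset in e *.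
  rewrite [[disjoint t & s]]disjoint_sym.
  case: [disjoint s & t]; rewrite ?andbF //= e st /= andbT.
  by [].
- apply: disjointW dab; exact: subsetDl.
by rewrite setD_eq0.
Qed.

End HalfMove.
End Moves.

(** * Bistellar moves, their invariants, and stellated spheres *)

Section StellarMoves.
Local Open Scope ring_scope.
Variables (F : fieldType) (N : nat).
Local Notation face := {set 'I_N}.
Local Notation chn := {ffun {set 'I_N} -> F^o}.
Local Notation C := (C F).
Local Notation Z := (Z F).
Local Notation B := (B F).
Local Notation hd := (hd F).
Local Notation D := (D F N).
Local Notation Inj := (Inj F).
Implicit Types (u v w x y : 'I_N) (s t a b A W : face) (c z : chn).
Implicit Types (i j k : nat) (X Y K L M : {set face}).

Lemma disjointD s t : [disjoint s & t :\: s].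
Proof. by rewrite disjoints_subset; apply/subsetP=> x xs; rewrite !inE xs. Qed.

Lemma setUDK s t : s \subset t -> s :|: (t :\: s) = t.
Proof.
move=> /subsetP st; apply/setP=> x; rewrite !inE.
by case xs: (x \in s); rewrite //= st.
Qed.

(** The faces of [join (simplex a) (bdry b)] are the subsets of [a :|: b] not containing [b], so a
    bistellar move becomes a pointwise condition. Here [n] is the number of vertices of a facet, not
    the dimension. *)
Definition smove n a b X Y :=
  [/\ [/\ a != set0, b != set0 & [disjoint a & b]],
      (#|a| + #|b|)%N = n.+1,
      (forall s, s \subset a :|: b -> (s \in X) = ~~ (b \subset s))
    & (forall s, (s \in Y) = if s \subset a :|: b then ~~ (a \subset s) else s \in X)].

Section MoveHS.
Variables (n : nat) (X Y : {set face}) (a b : face).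
Hypotheses (hX : HS F n X) (mv : smove n a b X Y).

Let cX : iscplx X. Proof. by case: hX. Qed.
Let a0 : a != set0. Proof. by case: mv => -[]. Qed.
Let b0 : b != set0. Proof. by case: mv => -[]. Qed.
Let dab : [disjoint a & b]. Proof. by case: mv => -[]. Qed.
Let dba : [disjoint b & a]. Proof. by rewrite disjoint_sym. Qed.
Let cab : (#|a| + #|b|)%N = n.+1. Proof. by case: mv. Qed.
Let EX s : s \subset a :|: b -> (s \in X) = ~~ (b \subset s).
Proof. by case: mv => _ _ + _; apply. Qed.
Let EY s : (s \in Y) = if s \subset a :|: b then ~~ (a \subset s) else s \in X.
Proof. by case: mv => _ _ _ ->. Qed.

(* The boundary of b is a top cycle of the link of a, so it has full support
   and that link has no other faces. *)
Lemma move_star s : s \in X -> a \subset s -> s \subset a :|: b.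
Proof.
move=> sX sa.
have aX : a \in X by apply: cX.2 sX sa.
have [m em] : exists m, #|b| = m.+1 by exists #|b|.-1; rewrite prednK // card_gt0.
have hL : HS F m (lk X a).
  by have := HS_lk hX aX; have -> : (n - #|a|)%N = m by move: cab; rewrite em; lia.
pose z := D (dl F b).
have zE t : z t != 0 -> exists2 v, v \notin t & v |: t = b.
  case/D_supp=> v vt; rewrite ffunE => H; exists v => //; apply/eqP.
  by apply: contraNT H => /negbTE->.
have Zz : z \in Z m (lk X a).
  rewrite memZ DD eqxx andbT; apply/memC=> t /zE[v vt e].
  have tb : t \subset b by rewrite -e subsetUr.
  have vb : v \in b by rewrite -e !inE eqxx.
  split; last by move: em; rewrite -e cardsU1 vt => -[].
  rewrite in_lk; have dat : [disjoint a & t] by rewrite disjoint_sym; apply: disjointWl tb dba.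
  rewrite dat EX ?setUS //; apply/negP=> /subsetP/(_ v vb); rewrite inE (negbTE vt) orbF.
  by rewrite (disjointFl dab vb).
have z0 : z != 0.
  have [v vb] := set0Pn _ b0.
  apply/eqP=> /ffunP/(_ (b :\ v)); rewrite DE ffunE (bigD1 v) ?inE ?eqxx //= ffunE setD1K // eqxx mulr1.
  rewrite big1 ?addr0; first by apply/eqP/sgn_neq0.
  move=> w /andP[wb wv]; rewrite ffunE; case: eqP => [e|]; last by rewrite mulr0.
  have : v \in w |: b :\ v by rewrite e.
  by rewrite !inE eqxx eq_sym (negbTE wv).
have sL : s :\: a \in lk X a.
  by rewrite in_lk disjointD setUDK.
have [s' s'L [ss' cs']] := HS_pure hL sL.
have zs' : z s' != 0.
  by apply: contraNneq z0 => zs; apply/eqP; apply: HS_full hL Zz s'L cs' zs.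
have [v _ e] := zE _ zs'.
by rewrite -subDset (subset_trans ss') // -e subsetUr.
Qed.

(** The point is [move_star]: a face outside [a :|: b] survives the move, so it must not contain the
    removed face [a]. *)
Lemma move_iscplx : iscplx Y.
Proof.
split; first by rewrite EY sub0set subset0.
move=> s t; rewrite !EY; case: ifPn => sab H ts.
  by rewrite (subset_trans ts sab); apply: contra H => /subset_trans; apply.
case: ifPn => tab; last exact: cX.2 H ts.
by apply: contra sab => at_; apply: move_star => //; apply: subset_trans ts.
Qed.

Definition trace : {set face} := [set s : face | (s \in X) || (s \subset a :|: b)].

Let cT : iscplx trace.
Proof.
split; first by rewrite inE cX.1.
move=> s t; rewrite !inE => /orP[sX ts|sab ts]; first by rewrite (cX.2 _ _ sX).
by rewrite (subset_trans ts sab) orbT.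
Qed.

Let abT : a :|: b \in trace. Proof. by rewrite inE subxx orbT. Qed.
Let baT : b :|: a \in trace. Proof. by rewrite setUC. Qed.

Let TX s : (s \in X) = (s \in trace) && ~~ ((b \subset s) && (s \subset a :|: b)).
Proof.
rewrite inE; case: (boolP (s \subset a :|: b)) => sab; first by rewrite EX // orbT andbT.
by rewrite orbF andbF andbT.
Qed.

Let TY s : (s \in Y) = (s \in trace) && ~~ ((a \subset s) && (s \subset b :|: a)).
Proof.
rewrite inE EY [b :|: a]setUC; case: ifP => sab; first by rewrite orbT andbT.
by rewrite orbF andbF andbT.
Qed.

(** Within [a :|: b], a face [s] containing [b] gets the boundary of [a :\: s] as its link, and a
    face containing neither [a] nor [b] keeps the homology of its link by passing through the trace.
    Outside, links are unchanged. *)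
Lemma move_HS : HS F n Y.
Proof.
have cY := move_iscplx; split=> // s sY; have := sY; rewrite EY; case: ifPn => sab.
  move=> nas; have [bs|nbs] := boolP (b \subset s); last first.
    have sX : s \in X by rewrite EX.
    have [sn e] := hX.2 _ sX; split=> // j; rewrite -e.
    rewrite -(half_lk F cX cT dab abT TX j sX sab nas).
    by rewrite (half_lk F cY cT dba baT TY) // setUC.
  have e : (#|s| + #|a :\: s|)%N = n.+1.
    rewrite -cab -(card_disjU dab) -card_disjU; last exact: disjointD.
    congr #|pred_of_set _|; apply/setP=> x; rewrite !inE.
    case xs: (x \in s) => /=; first by have := subsetP sab x xs; rewrite inE.
    by case xb: (x \in b); [rewrite (subsetP bs) in xs|rewrite orbF].
  have as0 : a :\: s != set0 by rewrite setD_eq0.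
  have c0 : (0 < #|a :\: s|)%N by rewrite card_gt0.
  split=> [|j]; first by lia.
  rewrite (_ : lk Y s = sphere (a :\: s)) ?hd_sphere //; first by congr (nat_of_bool _); lia.
  apply/setP=> t; rewrite in_lk in_sphere EY subUset sab /=.
  rewrite properE !subDset subsetD [[disjoint t & s]]disjoint_sym.
  have [dst|] := boolP [disjoint s & t]; last by rewrite andbF.
  rewrite andbT; case: ifPn => [/subsetP tab|tab].
    suff -> : t \subset a by [].
    apply/subsetP=> x xt; have := tab x xt; rewrite inE => /orP[//|/(subsetP bs) xs].
    by rewrite (disjointFr dst xs) in xt.
  rewrite [LHS](contraNF _ (_ : ~~ false)) //; last first.
    by move/cX.2/(_ (subsetUl _ _)); rewrite EX // bs.
  by apply/esym/negP=> /andP[ta _]; rewrite (subset_trans ta (subsetUl _ _)) in tab.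
move=> sX; have [sn e] := hX.2 _ sX; split=> // j; rewrite -e; congr (hd _ _).
apply/setP=> t; rewrite !in_lk EY ifN //.
by apply: contra sab => /(subset_trans _); apply; apply: subsetUl.
Qed.

(** Up to cancelling intervals, the trace exceeds X by at most the face [b] and Y by at most the
    face [a]; one face affects only the degrees of itself and of its boundary. *)
Lemma move_hd i A : i != #|b| -> i.+1 != #|b| -> i != #|a| -> i.+1 != #|a| ->
  hd i (ind Y A) = hd i (ind X A).
Proof.
move=> ib ib' ia ia'; have cY := move_iscplx.
have cI K : iscplx K -> iscplx (ind K A) by move=> ?; apply: iscplx_ind.
transitivity (hd i (ind trace A)).
  have [e|ne] := eqVneq (A :&: (b :|: a)) a; last by rewrite (half_ind F cY cT dba baT TY).
  by have [-> _] := half_ind_face cT baT TY e; rewrite addface_hd.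
have [e|ne] := eqVneq (A :&: (a :|: b)) b; last by rewrite (half_ind F cX cT dab abT TX).
by have [-> _] := half_ind_face cT abT TX e; rewrite addface_hd.
Qed.

(** The face [b] lies within the truncation and counts with its sign; [a] lies above it and goes
    unnoticed. *)
Lemma move_tchi k A : (#|b| <= k)%N -> (k.+1 < #|a|)%N ->
  tchi F k (ind Y A) = tchi F k (ind X A) + (A :&: (a :|: b) == b)%:R * (-1) ^+ #|b|.
Proof.
move=> bk ak; have cY := move_iscplx.
have tchi_eq K L : (forall j, hd j K = hd j L) -> tchi F k K = tchi F k L.
  by move=> e; apply: eq_bigr => j _; rewrite e.
have cI K : iscplx K -> iscplx (ind K A) by move=> ?; apply: iscplx_ind.
transitivity (tchi F k (ind trace A)).
  have [e|ne] := eqVneq (A :&: (b :|: a)) a.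
    have [e' aI] := half_ind_face cT baT TY e.
    by rewrite e' tchi_addface_big //; [exact: cI|rewrite -e'; exact: cI].
  by apply: tchi_eq => j; rewrite (half_ind F cY cT dba baT TY).
have [e|ne] := eqVneq (A :&: (a :|: b)) b.
  have [e' bI] := half_ind_face cT abT TX e.
  by rewrite e' tchi_addface ?mul1r //; [exact: cI|rewrite -e'; exact: cI].
by rewrite mul0r addr0; apply: tchi_eq => j; rewrite (half_ind F cX cT dab abT TX).
Qed.

End MoveHS.

Inductive stell (k d : nat) : {set face} -> Prop :=
| stell_sphere a : #|a| = d.+2 -> stell k d (sphere a)
| stell_move X Y a b : stell k d X -> smove d.+1 a b X Y -> (#|b| <= k)%N -> stell k d Y.

Lemma stell_HS k d X : stell k d X -> HS F d.+1 X.
Proof. by elim=> [a /HS_sphere //|{}X Y a b _ hX mv _]; apply: move_HS hX mv. Qed.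

(** Moves with [#|b| <= k] have [#|a| >= d + 2 - k], so no move touches the degrees strictly between
    [k] and [d + 1 - k]. *)
Lemma stell_mid k d X A i : stell k d X -> (k < i)%N -> (i + k <= d)%N -> hd i (ind X A) = 0%N.
Proof.
move=> sX ki ikd; elim: sX => [a ca|{}X Y a b /stell_HS hX IH mv bk].
  by apply: hd_ind_sphere; rewrite ?ca; lia.
apply: etrans IH; case: (mv) => _ cab _ _; apply: (move_hd hX mv); lia.
Qed.

End StellarMoves.

(** * Induced subcomplexes of neighbourly homology spheres *)

Section Neighbourly.
Local Open Scope ring_scope.
Variables (F : fieldType) (N : nat).
Local Notation face := {set 'I_N}.
Local Notation chn := {ffun {set 'I_N} -> F^o}.
Local Notation C := (C F).
Local Notation Z := (Z F).
Local Notation B := (B F).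
Local Notation hd := (hd F).
Local Notation D := (D F N).
Local Notation Inj := (Inj F).
Implicit Types (u v w x y : 'I_N) (s t a b A W : face) (c z : chn).
Implicit Types (i j k : nat) (X Y K L M : {set face}).

Definition vs K : face := [set x | [set x] \in K].
Definition nb k K := forall A, A \subset vs K -> (#|A| <= k)%N -> A \in K.

Lemma face_vs K s : iscplx K -> s \in K -> s \subset vs K.
Proof.
by move=> [_ clK] sK; apply/subsetP=> x xs; rewrite inE; apply: clK sK _; rewrite sub1set.
Qed.

Lemma ind_vs K A : iscplx K -> vs K \subset A -> ind K A = K.
Proof.
move=> cK H; apply/setP=> s; rewrite in_ind; case sK: (s \in K) => //=.
by apply: subset_trans H; apply: face_vs.
Qed.

Lemma vs_lk K x : iscplx K -> nb 2 K -> [set x] \in K -> vs (lk K [set x]) = vs K :\ x.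
Proof.
move=> cK nK xK; apply/setP=> y; rewrite !inE disjoints1 inE eq_sym.
case: eqVneq => //= yx; apply/idP/idP => [/cK.2|yK]; first by apply; apply: subsetUr.
apply: nK; first by rewrite subUset !sub1set !inE xK.
by rewrite cardsU1 cards1 inE; case: (_ == _).
Qed.

Lemma nbW k l K : nb k K -> (l <= k)%N -> nb l K.
Proof. by move=> nK lk A AK /leq_trans/(_ lk); apply: nK. Qed.

Lemma nb_lk k K x : iscplx K -> nb k.+1 K -> (0 < k)%N -> [set x] \in K ->
  nb k (lk K [set x]).
Proof.
move=> cK nK k0 xK A; rewrite vs_lk //; last exact: nbW nK _.
rewrite subsetD1 => /andP[AK xA] Ak; rewrite in_lk1 xA; apply: nK.
  by rewrite subUset sub1set inE xK.
by rewrite cardsU1 xA.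
Qed.

Lemma nb_hd0 k K A j : iscplx K -> nb k K -> A \subset vs K -> A != set0 -> (j < k)%N ->
  hd j (ind K A) = 0%N.
Proof.
move=> cK nK AK /set0Pn[x xA] jk; apply: (@cone_hd0 _ _ _ A j x) => //.
- exact: iscplx_ind.
- by move=> s; rewrite in_ind => /andP[].
move=> s sA sj; rewrite in_ind sA andbT; apply: nK; first exact: subset_trans AK.
exact: leq_trans jk.
Qed.

Lemma hd_ind0 K j : iscplx K -> hd j (ind K set0) = (j == 0%N).
Proof.
move=> cK; rewrite -(hd_empty F N); congr (hd _ _); apply/setP=> s; rewrite in_ind inE subset0.
by rewrite andbC; case: eqP => //= ->; rewrite cK.1.
Qed.

(** A top cycle supported on [A] misses every facet through a vertex outside [A], against full
    support. *)
Lemma HS_top n K A i : HS F n K -> A \proper vs K -> (n <= i)%N -> hd i (ind K A) = 0%N.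
Proof.
move=> hK /properP[AK [y yK yA]] ni.
apply: hd0; suff -> : Z i (ind K A) = 0%VS by apply: sub0v.
have indK : ind K A \subset K by apply/subsetP=> s; rewrite in_ind => /andP[].
have [lt|ge] := ltnP n i.
  rewrite /Z (C_big F (n := n)) ?cap0v // => s /(subsetP indK) sK; exact: (hK.2 _ sK).1.
have {ge ni} e : i = n by apply/eqP; rewrite eqn_leq ge ni.
rewrite inE in yK; have [s0 s0K [ys cs]] := HS_pure hK yK.
apply/eqP; rewrite -subv0 e; apply/subvP=> z Zz; rewrite memv0.
have Zz' := subvP (ZS F _ indK) _ Zz; apply/eqP/(HS_full hK Zz' s0K cs).
apply/eqP; apply: contraNT yA => zs; move: Zz; rewrite memZ => /andP[/memC/(_ _ zs)[+ _] _].
by rewrite in_ind => /andP[_ /subsetP]; apply; rewrite -sub1set.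
Qed.

(** Restoring [y] kills nothing outside degree [n], the only one where its link has homology. In
    degree [n], a filling in K is corrected by the top cycle so as to avoid [y]. *)
Lemma HS_punctured n K y i : HS F n.+1 K -> y \in vs K -> hd i (ind K (vs K :\ y)) = 0%N.
Proof.
move=> hK yK; have cK := hK.1; have yK' : [set y] \in K by rewrite inE in yK.
have [le|lt] := leqP n.+1 i.
  by apply: (HS_top hK) => //; rewrite properE subD1set subsetD1 yK ?subxx andbF.
set A := vs K :\ y; set X := ind K A.
have yA : y \notin A by rewrite !inE eqxx.
have eY : ind K (y |: A) = K by rewrite ind_vs // setD1K.
have cX : iscplx X by apply: iscplx_ind.
have XK : X \subset K by apply/subsetP=> s; rewrite in_ind => /andP[].
have hL : HS F n (lk K [set y]) by apply: HS_lk1.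
have eL : ind (lk K [set y]) A = lk K [set y].
  apply: ind_vs; first exact: hL.1.
  apply/subsetP=> x; rewrite [x \in vs _]inE in_lk1 !inE eq_sym => /andP[-> /cK.2]; apply.
  exact: subsetUr.
have hdK : hd i K = 0%N by rewrite (HS_hd _ hK) ltn_eqF.
have [e|ne] := eqVneq i n; last first.
  apply: (hd0_Inj cK XK) => //; rewrite -eY; apply: ind_addv_Inj => //.
  by rewrite eL (HS_hd _ hL) (negbTE ne).
have [s0 s0K [ys cs]] := HS_pure hK yK'; rewrite sub1set in ys.
have : Z n.+1 K != 0%VS by rewrite -dimv_eq0 -(hd_dim F _ cK) (HS_hd _ hK) eqxx.
rewrite -vpick0; set ze := vpick _ => ze0.
have Zze : ze \in Z n.+1 K by apply: memv_pick.
have zes : ze s0 != 0 by apply: contraNneq ze0 => /(HS_full hK Zze s0K cs)->.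
apply: hd0; apply/subvP=> z Zz; rewrite e in Zz hdK *.
have := subvP (ZS F _ XK) _ Zz; rewrite hd0P // => /memB[w Cw ez].
(* The coefficient makes [w'] vanish at a facet through [y]. Its part through [y] is then a top
   cycle of the link missing a facet, hence zero. *)
pose w' := w - (w s0 / ze s0) *: ze.
have Dze : D ze = 0 by move: Zze; rewrite memZ => /andP[_ /eqP].
have Dw : D w' = z by rewrite linearB linearZ /= Dze scaler0 subr0.
have Cw' : w' \in C n.+1 K.
  by rewrite rpredB // rpredZ //; move: Zze; rewrite memZ => /andP[].
have Xz : on X z by move: Zz; rewrite memZ => /andP[/memC_on].
have cz : contr F y z = 0.
  apply/ffunP=> t; rewrite contrE ffunE; case: ifPn => // yt.
  have [->|/Xz] := eqVneq (z (y |: t)) 0; first by rewrite mulr0.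
  by rewrite in_ind subUset sub1set (negbTE yA) andbF.
have cw : contr F y w' = 0.
  apply: (HS_full hL (s0 := s0 :\ y)).
  - by rewrite memZ contr_lk //= D_contr Dw cz oppr0.
  - by rewrite in_lk1 !inE eqxx setD1K.
  - by move: cs; rewrite (cardsD1 y) ys => -[].
  apply/eqP; rewrite contr_eq0 // !ffunE /GRing.scale /= divfK // subrr //.
apply/memB; exists w' => //; apply: (on_memC Cw') => s ws.
have sK : s \in K by case/memC/(_ _ ws): Cw'.
rewrite in_ind sK subsetD1 face_vs //=; apply: contra ws => ys'.
by rewrite -(contr_eq0 _ ys') cw ffunE.
Qed.

(** Alexander dual of [nb_hd0]. A vertex [y] outside [A] is fixed and [A] grows to the acyclic
    complement of [y]. Adding [x] kills nothing, by induction in the link of [x]: the current set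
    stays proper there because it misses [y]. *)
Lemma HS_nb_hd0 k n K A i : HS F n K -> nb k K -> (0 < k)%N -> (k <= n)%N ->
  A \proper vs K -> (n < i + k)%N -> hd i (ind K A) = 0%N.
Proof.
elim: k n K A i => // k IH n K A i hK nK _ kn AK nik; have cK := hK.1.
have [k0|k0] := posnP k.
  by apply: (HS_top hK AK); rewrite k0 addn1 ltnS in nik.
case: n kn hK nik => // n kn hK nik.
have [sAK [y yK yA]] := properP AK.
have AKy : A \subset vs K :\ y by rewrite subsetD1 sAK.
apply: (hd0_Inj (Y := ind K (vs K :\ y))); first exact: iscplx_ind.
- exact: indS.
- apply: Inj_grow => // A' x AA' xA' nx.
  move: xA'; rewrite subUset sub1set 2!inE => /andP[/andP[xy xK] A'K].
  have xK' : [set x] \in K by rewrite inE in xK.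
  apply: ind_addv_Inj => //; apply: (IH n) => //.
  - exact: HS_lk1.
  - exact: nb_lk.
  - rewrite vs_lk //; last by apply: nbW nK _; rewrite ltnS.
    apply/properP; split; first by rewrite subsetD1 nx andbT; move: A'K; rewrite subsetD1 => /andP[].
    exists y; first by rewrite !inE eq_sym xy; rewrite inE in yK.
    by move: A'K; rewrite subsetD1 => /andP[].
  - by rewrite addnS ltnS in nik.
exact: HS_punctured hK yK.
Qed.

End Neighbourly.

(** * Injectivity outside the critical degree *)

Section Manifold.
Local Open Scope ring_scope.
Variables (F : fieldType) (N : nat).
Local Notation face := {set 'I_N}.
Local Notation chn := {ffun {set 'I_N} -> F^o}.
Local Notation C := (C F).
Local Notation Z := (Z F).
Local Notation B := (B F).
Local Notation hd := (hd F).
Local Notation D := (D F N).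
Local Notation Inj := (Inj F).
Implicit Types (u v w x y : 'I_N) (s t a b A W : face) (c z : chn).
Implicit Types (i j k : nat) (X Y K L M : {set face}).
Variables (k e : nat) (M : {set face}).
Let d := e.+1.
Hypotheses (cM : iscplx M) (k2 : (1 < k)%N) (kd : (k <= d)%N).
Hypothesis (dimM : forall s, s \in M -> (#|s| <= d.+1)%N).
Hypothesis (lkM : forall x, x \in vs M -> stell k e (lk M [set x])).
Hypothesis (nbM : nb k.+1 M).

Let k0 : (0 < k)%N. Proof. exact: ltnW. Qed.

Lemma mf_vertex x : x \in vs M -> [set x] \in M.
Proof. by rewrite inE. Qed.

Lemma mf_HS x : x \in vs M -> HS F d (lk M [set x]).
Proof. by move=> /lkM/(stell_HS F). Qed.

Lemma mf_nb x : x \in vs M -> nb k (lk M [set x]).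
Proof. by move=> /mf_vertex xM; apply: nb_lk. Qed.

Lemma mf_vs x : x \in vs M -> vs (lk M [set x]) = vs M :\ x.
Proof. by move=> /mf_vertex xM; apply: vs_lk => //; apply: nbW nbM _. Qed.

(* For nonempty proper B only the degrees k and d - k survive: below k by
   neighbourliness, above d - k by its dual form, in between by stellatedness. *)
Lemma mf_lk_hd0 x A j : x \in vs M -> A \subset vs M :\ x -> (0 < j)%N -> j != d ->
  [|| (j < k)%N, (d < j + k)%N | (k < j)%N && (j + k < d)%N] ->
  hd j (ind (lk M [set x]) A) = 0%N.
Proof.
move=> xM AM j0 jd H; have hL := mf_HS xM; have nL := mf_nb xM.
have [->|A0] := eqVneq A set0; first by rewrite hd_ind0 ?(gtn_eqF j0) //; exact: hL.1.
rewrite -(mf_vs xM) in AM.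
have [eA|nA] := eqVneq A (vs (lk M [set x])).
  rewrite eA ind_vs //; last exact: hL.1.
  by rewrite (HS_hd _ hL) (negbTE jd).
case/or3P: H => [jk|djk|/andP[kj jkd]].
- by apply: nb_hd0 nL AM A0 jk; exact: hL.1.
- by apply: HS_nb_hd0 hL nL k0 kd _ djk; rewrite properEneq nA.
by apply: (stell_mid _ _ (lkM xM)) => //.
Qed.

Lemma mf_hd0 A j : A \subset vs M -> (0 < j)%N -> j != d ->
  [|| (j < k)%N, (d < j + k)%N | (k < j)%N && (j + k < d)%N] ->
  hd j.+1 (ind M A) = 0%N.
Proof.
move=> AM j0 jd H; have [n le_n] := ubnP #|A|; elim: n A AM le_n => // n IH A AM le_n.
have [->|/set0Pn[x xA]] := eqVneq A set0; first by rewrite hd_ind0.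
have xM := subsetP AM _ xA; have AxM : A :\ x \subset vs M by apply: subset_trans AM; exact: subD1set.
rewrite -(setD1K xA); apply: ind_addv_hd0 => //.
- exact: mf_vertex.
- by rewrite !inE eqxx.
- by apply: mf_lk_hd0 => //; apply: setSD.
by apply: IH => //; move: le_n; rewrite (cardsD1 x) xA.
Qed.

(** A class of degree [i] is killed only by degree [i] of a link, which for [k < i < d] leaves
    [i = d - k]. There M[A] itself has no homology, since degree [i - 1] of the links vanishes,
    unless [i - 1 = k], that is [d = 2k + 1]. *)
Lemma mf_Inj A i : A \subset vs M -> (0 < i)%N ->
  ~~ ((d == 2 * k + 1)%N && (i == k.+1)) -> Inj i (ind M A) M.
Proof.
move=> AM i0 crit; have eM : ind M (vs M) = M by rewrite ind_vs.
have [->|A0] := eqVneq A set0; first by apply: Inj_hd0; rewrite ?hd_ind0 ?(gtn_eqF i0) //; apply: iscplx_ind.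
have [ik|ki] := ltnP i k.+1.
  by apply: Inj_hd0; [exact: iscplx_ind|exact: nb_hd0 nbM AM A0 ik].
have [id|id] := ltnP d i.
  by rewrite /Inj /B (C_big F dimM) ?limg0 ?cap0v ?sub0v.
have crit' : (i + k != d)%N || (k.+1 < i)%N.
  by apply: contraTT ki; rewrite negb_or negbK -leqNgt => /andP[/eqP ikd ik1];
     rewrite -leqNgt leqNgt; apply: contra crit => ki; apply/andP; split; apply/eqP; lia.
have [ikd|nikd] := eqVneq (i + k)%N d.
  apply: Inj_hd0; first exact: iscplx_ind.
  move: i0 crit crit' ki id ikd; case: i => // i _ crit crit' ki id ikd.
  rewrite ikd eqxx /= in crit'.
  by apply: mf_hd0 => //; lia.
have lkA' A' x : A \subset A' -> x |: A' \subset vs M -> x \notin A' ->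
    [/\ x \in vs M, A' \subset vs M :\ x & A' != set0].
  rewrite subUset sub1set => AA' /andP[xM A'M] xA'; split => //; first by rewrite subsetD1 A'M.
  by apply: contraNneq A0 => e0; rewrite e0 subset0 in AA'.
rewrite -[X in Inj _ _ X]eM; apply: Inj_grow => // A' x AA' xA'M xA'.
have [xM A'M A'0] := lkA' _ _ AA' xA'M xA'.
(* In degree [d] the whole link is a sphere and does have homology. It is met only when [A']
   consists of all other vertices, and then M[A'] has no homology in degree [d], because
   [d < d - 1 + k]. *)
have [eid|nid] := eqVneq i d; last first.
  by apply: ind_addv_Inj => //; [exact: mf_vertex|apply: mf_lk_hd0 => //; lia].
have [eA|neA] := eqVneq A' (vs M :\ x).
  apply: Inj_hd0; first exact: iscplx_ind.
  move: i0 ki id nikd eid; case: i {crit crit'} => // i _ ki id nikd eid.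
  by apply: mf_hd0 => //; rewrite ?(subset_trans A'M) ?subD1set //; lia.
apply: ind_addv_Inj => //; first exact: mf_vertex.
apply: HS_top (mf_HS xM) _ _; last by rewrite eid.
by rewrite mf_vs // properEneq neA.
Qed.

(** Neighbourliness kills degree [k] of M[A], which is the last term of the exact sequence. *)
Lemma mf_critical_hd A x : A \subset vs M -> x \in vs M -> x \notin A ->
  (hd k.+1 (ind M (x |: A)) + killed F k.+1 (ind M A) (ind M (x |: A)) =
   hd k.+1 (ind M A) + hd k (ind (lk M [set x]) A))%N.
Proof.
move=> AM xM xA; case: k k0 k2 nbM => // m _ m1 nM.
apply: ind_addv_hd => //; first exact: mf_vertex.
have [->|A0] := eqVneq A set0; first by rewrite hd_ind0.
exact: nb_hd0 nM AM A0 _.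
Qed.

Lemma mf_critical_Inj :
  (forall A, A \subset vs M -> Inj k.+1 (ind M A) M) <->
  (forall A x, x \in vs M -> A \subset vs M :\ x -> killed F k.+1 (ind M A) (ind M (x |: A)) = 0%N).
Proof.
have eM : ind M (vs M) = M by rewrite ind_vs.
split=> [H A x xM | H A AM].
  rewrite subsetD1 => /andP[AM xA]; apply/eqP; rewrite ind_killed_eq0 ?(mf_vertex xM) //.
  apply: Inj_sub (H A AM).
  by apply/subsetP=> s; rewrite in_ind => /andP[].
rewrite -[X in Inj _ _ X]eM; apply: Inj_grow => // A' x AA'.
rewrite subUset sub1set => /andP[xM A'M] xA'.
by rewrite -ind_killed_eq0 ?(mf_vertex xM) // H // subsetD1 A'M.
Qed.

End Manifold.

(** * Binomial identities and order probabilities *)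

Section Binomials.
Local Open Scope ring_scope.

(** Both sides count multisets of size [j] from [t + (q - j + 1)] kinds, split on the right-hand
    kinds: ['C(q - i, j - i)] counts those of size [j - i] from [q - j + 1] kinds. For [t = 0] the
    truncated predecessor gives 1 at [i = 0] and 0 elsewhere, as it should. *)
Lemma multiset_vandermonde t q j : (j <= q)%N ->
  (\sum_(i < j.+1) 'C((t + i).-1, i) * 'C(q - i, j - i) = 'C(t + q, j))%N.
Proof.
elim: t q j => [|t IHt] q j jq.
  rewrite big_ord_recl !subn0 bin0 mul1n big1 ?addn0 // => i _.
  by rewrite bin_small // /bump /= add0n.
elim: j q jq => [|j IHj] q jq.
  by rewrite big_ord_recl big_ord0 !bin0.
case: q jq => // q jq; rewrite ltnS in jq.
rewrite big_ord_recl /= bin0 mul1n !subn0.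
under eq_bigr => i _ do rewrite /bump /= add1n addnS binS mulnDl !subSS.
rewrite big_split /= addnA.
have -> : ('C(q.+1, j.+1) + \sum_(i < j.+1) 'C(t + i, i.+1) * 'C(q - i, j - i))%N
    = 'C(t + q.+1, j.+1).
  rewrite -IHt // [RHS]big_ord_recl bin0 mul1n !subn0; congr (_ + _)%N.
  by apply: eq_bigr => i _; rewrite /= /bump /= add1n addnS /= !subSS.
have -> : (\sum_(i < j.+1) 'C(t + i, i) * 'C(q - i, j - i) = 'C(t.+1 + q, j))%N.
  by rewrite -IHj //; apply: eq_bigr => i _.
by rewrite addSnnS [in RHS]addSn binS.
Qed.

(* The probability that, in a random ordering of p + q + 1 elements, a given
   element comes after p given ones and before the q others. *)
Definition wt (p q : nat) : rat := (p`! * q`!)%:R / (p + q).+1`!%:R.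

Lemma fact_neq0 n : n`!%:R != 0 :> rat.
Proof. by rewrite pnatr_eq0 -lt0n fact_gt0. Qed.

Lemma wt_gt0 p q : 0 < wt p q.
Proof. by rewrite divr_gt0 // ltr0n ?muln_gt0 ?fact_gt0. Qed.

(** A further element falls either before or after the given one. *)
Lemma wt_split p q : wt p.+1 q + wt p q.+1 = wt p q.
Proof.
rewrite /wt addnS addSn -mulrDl -natrD.
have -> : (p.+1`! * q`! + p`! * q.+1`! = (p + q).+2 * (p`! * q`!))%N.
  by rewrite !factS; ring.
rewrite [(p + q).+2`!]factS !(natrM _ (p + q).+2).
have := fact_neq0 (p + q).+1; have : (p + q).+2%:R != 0 :> rat by rewrite pnatr_eq0.
move: (p + q).+2%:R (p + q).+1`!%:R (p`! * q`!)%:R => x y z x0 y0.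
by field; rewrite x0 y0.
Qed.

Lemma wt_succl p q : p.+1%:R * wt p q = (p.+1`! * q`!)%:R / (p + q).+1`!%:R.
Proof. by rewrite /wt mulrA -natrM factS !mulnA. Qed.

Lemma wt_succr p q : q.+1%:R * wt p q = (p`! * q.+1`!)%:R / (p + q).+1`!%:R.
Proof. by rewrite /wt mulrA -natrM factS mulnCA. Qed.

(** The partial sums telescope: [(j + 1) * 'C(t + j, j + 1) = (t + j) * 'C(t + j - 1, j)], and
    [t + j] is what remains of [d + 1 + t] after subtracting [d + 1 - j]. *)
Lemma alternating_wt_sum t d j : (j <= d.+1)%N ->
  1 - (d.+1 + t)%:R * \sum_(i < j) (-1) ^+ i * 'C((t + i).-1, i)%:R * wt i (d - i)
  = (-1) ^+ j * 'C((t + j).-1, j)%:R * (j`! * (d.+1 - j)`!)%:R / d.+1`!%:R :> rat.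
Proof.
elim: j => [|j IH] jd.
  by rewrite big_ord0 mulr0 subr0 bin0 expr0 fact0 mul1n subn0 !mul1r divff ?fact_neq0.
rewrite big_ord_recr /= mulrDr opprD addrA IH; last exact: ltnW.
rewrite addnS /= subSS subSn // factS mulnCA natrM.
have e : (j.+1%:R * 'C(t + j, j.+1)%:R = (t + j)%:R * 'C((t + j).-1, j)%:R :> rat).
  by rewrite -!natrM; congr _%:R; case: (t + j)%N => [|m]; rewrite ?bin0n ?muln0 ?mul0n // mul_bin_diag.
rewrite /wt subnKC // factS.
have -> : (-1) ^+ j.+1 * 'C(t + j, j.+1)%:R * (j.+1 * j`! * (d - j)`!)%:R =
   - ((-1) ^+ j * (j.+1%:R * 'C(t + j, j.+1)%:R) * (j`! * (d - j)`!)%:R) :> rat.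
  by rewrite exprS !natrM; ring.
rewrite e -subSn // natrB; last exact: ltnW.
rewrite (natrD _ d.+1 t) (natrD _ t j).
move: ((-1) ^+ j) ('C((t + j).-1, j)%:R) ((j`! * (d - j)`!)%:R) => x y z.
by move: d.+1%:R t%:R j%:R (d.+1 * d`!)%:R^-1 => ? ? ? ?; ring.
Qed.

End Binomials.

(** * Averages over random orderings *)

Section Averages.
Local Open Scope ring_scope.
Variables (F : fieldType) (N : nat).
Local Notation face := {set 'I_N}.
Local Notation chn := {ffun {set 'I_N} -> F^o}.
Local Notation C := (C F).
Local Notation Z := (Z F).
Local Notation B := (B F).
Local Notation hd := (hd F).
Local Notation D := (D F N).
Local Notation Inj := (Inj F).
Implicit Types (u v w x y : 'I_N) (s t a b A W : face) (c z : chn).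
Implicit Types (i j k : nat) (X Y K L M : {set face}).

Lemma big_subset_D1 (f : face -> rat) W y : y \in W ->
  \sum_(A : face | A \subset W) f A = \sum_(A : face | A \subset W :\ y) (f A + f (y |: A)).
Proof.
move=> yW; rewrite big_split /= (bigID (fun A : face => y \notin A)) /=; congr (_ + _).
  by apply: eq_bigl => A; rewrite subsetD1.
rewrite (reindex_onto (fun A => y |: A) (fun A => A :\ y)) /=; last first.
  by move=> A /andP[_]; rewrite negbK => /setD1K.
apply: eq_bigl => A; rewrite subsetD1 subUset sub1set yW !inE eqxx /=.
case yA: (y \in A) => /=; last by rewrite setU1K ?yA // eqxx !andbT.
by rewrite !andbF; apply/andP=> -[_ /eqP e]; move: yA; rewrite -e !inE eqxx.
Qed.

(* Beta integral: for x placed uniformly at random among W, the probability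
   that exactly the elements b of T precede x depends on T alone. *)
Lemma avg_trace W (T : face) b : T \subset W -> b \subset T ->
  \sum_(A : face | A \subset W) wt #|A| (#|W| - #|A|) * (A :&: T == b)%:R = wt #|b| (#|T| - #|b|).
Proof.
move=> TW bT; have [n le_n] := ubnP #|W|; elim: n W TW le_n => // n IH W TW le_n.
have [WT|/subsetPn[y yW yT]] := boolP (W \subset T).
  have -> : W = T by apply/eqP; rewrite eqEsubset WT.
  rewrite (bigD1 b) //= (setIidPl bT) eqxx mulr1 big1 ?addr0 // => A /andP[AT /negbTE nb].
  by rewrite (setIidPl AT) nb mulr0.
rewrite (big_subset_D1 _ yW) -(IH (W :\ y)) //; first last.
- by move: le_n; rewrite (cardsD1 y) yW.
- by rewrite subsetD1 TW.
apply: eq_bigr => A; rewrite subsetD1 => /andP[AW yA].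
have -> : (y |: A) :&: T = A :&: T.
  by apply/setP=> x; rewrite !inE; case: (x =P y) => //= ->; rewrite (negbTE yT) andbF.
rewrite -mulrDl; congr (_ * _); rewrite cardsU1 yA /= add1n.
have cW : #|W| = #|W :\ y|.+1 by rewrite (cardsD1 y) yW.
have le : (#|A| <= #|W :\ y|)%N by apply: subset_leq_card; rewrite subsetD1 AW.
by rewrite cW subSS subSn // addrC wt_split.
Qed.

(** Along each ordering of [W] the increments of [g] on successive initial segments telescope; the
    left side is the expectation of their sum. *)
Lemma telescope_orders (g : face -> rat) W : W != set0 ->
  \sum_(x in W) \sum_(A : face | A \subset W :\ x) wt #|A| (#|W|.-1 - #|A|) * (g (x |: A) - g A)
  = g W - g set0.
Proof.
move=> W0; have [n eW] : exists n, #|W| = n.+1 by exists #|W|.-1; rewrite prednK // card_gt0.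
(* The probability that [A] is an initial segment of the ordering. Every [A] is entered and left
   with this same weight, except that nothing enters the empty set and nothing leaves [W]. *)
pose v (A : face) : rat := ((#|A|)`! * (n.+1 - #|A|)`!)%:R / n.+1`!%:R.
have -> : \sum_(x in W) \sum_(A : face | A \subset W :\ x) wt #|A| (#|W|.-1 - #|A|) * (g (x |: A) - g A)
  = \sum_(A : face | A \subset W) \sum_(x in A) wt #|A|.-1 (n.+1 - #|A|) * g A
    - \sum_(A : face | A \subset W) \sum_(x in W :\: A) wt #|A| (n - #|A|) * g A.
  rewrite [X in _ = X - _](exchange_big_dep (mem W)) /=; last by move=> A x /subsetP AW /AW.
  rewrite [X in _ = _ - X](exchange_big_dep (mem W)) /=; last by move=> A x _; rewrite inE => /andP[].
  rewrite -sumrB; apply: eq_bigr => x xW.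
  under eq_bigr => A _ do rewrite mulrBr eW /=.
  rewrite sumrB; congr (_ - _); last first.
    by apply: eq_bigl => A; rewrite subsetD1 inE xW andbT.
  rewrite [RHS](reindex_onto (fun A => x |: A) (fun A => A :\ x)) /=; last first.
    by move=> A /andP[_] /setD1K.
  apply: eq_big => [A|A].
    rewrite subsetD1 subUset sub1set xW !inE eqxx /=.
    case xA: (x \in A) => /=; last by rewrite setU1K ?xA // eqxx !andbT.
    by rewrite !andbF; apply/esym/andP=> -[_ /eqP e]; move: xA; rewrite -e !inE eqxx.
  by rewrite subsetD1 => /andP[_ xA]; rewrite cardsU1 xA add1n /= subSS.
have eL A : A \subset W -> \sum_(x in A) wt #|A|.-1 (n.+1 - #|A|) * g A = (A != set0)%:R * v A * g A.
  move=> AW; rewrite sumr_const -mulrnAl -[_ *+ _]mulr_natl; congr (_ * _).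
  have := subset_leq_card AW; rewrite eW -card_gt0 /v.
  case: #|A| => [|m] le; first by rewrite !mul0r.
  by rewrite wt_succl mul1r subSS /= subnKC.
have eR A : A \subset W -> \sum_(x in W :\: A) wt #|A| (n - #|A|) * g A = (A != W)%:R * v A * g A.
  move=> AW; rewrite sumr_const -mulrnAl -[_ *+ _]mulr_natl; congr (_ * _).
  rewrite cardsD (setIidPr AW) eW /v; have [->|nAW] := eqVneq A W; first by rewrite eW subnn !mul0r.
  have lt : (#|A| < #|W|)%N by apply: proper_card; rewrite properEneq nAW.
  rewrite eW ltnS in lt; rewrite subSn // wt_succr mul1r subnKC //.
rewrite (eq_bigr _ eL) (eq_bigr _ eR) -sumrB.
have v1 : v W = 1 by rewrite /v eW subnn fact0 muln1 divff ?fact_neq0.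
have v0 : v set0 = 1 by rewrite /v cards0 subn0 fact0 mul1n divff ?fact_neq0.
rewrite (bigD1 W) //= (bigD1 set0) /=; last by rewrite sub0set eq_sym.
rewrite big1 => [|A /andP[/andP[_ ->] ->]]; last by rewrite subrr.
by rewrite !eqxx W0 eq_sym W0 v1 v0 !mul1r !mul0r subr0 sub0r addr0.
Qed.

End Averages.

(** * Counting moves by index from the numbers of faces *)

Section MoveCount.
Local Open Scope ring_scope.
Variables (F : fieldType) (N : nat).
Local Notation face := {set 'I_N}.
Local Notation chn := {ffun {set 'I_N} -> F^o}.
Local Notation C := (C F).
Local Notation Z := (Z F).
Local Notation B := (B F).
Local Notation hd := (hd F).
Local Notation D := (D F N).
Local Notation Inj := (Inj F).
Implicit Types (u v w x y : 'I_N) (s t a b A W : face) (c z : chn).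
Implicit Types (i j k : nat) (X Y K L M : {set face}).
Implicit Types (G : nat -> nat) (T : face).

Lemma vs_sphere a : (1 < #|a|)%N -> vs (sphere a) = a.
Proof.
move=> a1; apply/setP=> x; rewrite !inE properEcard sub1set cards1 a1 andbT //.
Qed.

Section VsMove.
Variables (n : nat) (X Y : {set face}) (a b : face).
Hypotheses (mv : smove n a b X Y) (a1 : (1 < #|a|)%N).

Let small x : ~~ (a \subset [set x]).
Proof. by apply: contraL a1 => /subset_leq_card; rewrite cards1 leqNgt. Qed.

Lemma smove_vsX : vs X \subset vs Y.
Proof.
case: mv => _ _ _ EY; apply/subsetP=> x; rewrite !inE EY => ->.
by rewrite small if_same.
Qed.

Lemma smove_vs_ab : a :|: b \subset vs Y.
Proof.
by case: mv => _ _ _ EY; apply/subsetP=> x xab; rewrite inE EY sub1set xab small.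
Qed.

(** Below [#|a|] no face is lost, and the gained ones are the unions of [b] with a subset of [a].
    The factor [#|b| <= j] guards the truncated subtraction. *)
Lemma smove_count j : (j < #|a|)%N ->
  #|[set s in Y | #|s| == j]| =
    (#|[set s in X | #|s| == j]| + (#|b| <= j) * 'C(#|a|, j - #|b|))%N.
Proof.
case: mv => [[_ _ dab] _ EX EY] ja.
have -> : [set s in Y | #|s| == j] =
    [set s in X | #|s| == j] :|: [set b :|: t | t : {set 'I_N} & (t \subset a) && (#|t| + #|b| == j)%N].
  apply/setP=> s; rewrite !inE; apply/andP/orP => [[]|].
    rewrite EY; case: ifPn => [sab _ sj|_ -> ->]; last by left.
    have [bs|nbs] := boolP (b \subset s); last by left; rewrite EX // nbs.
    right; apply/imsetP; exists (s :\: b); last by rewrite setUDK.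
    rewrite inE subDset setUC sab -(eqP sj) addnC.
    by have := card_disjU (disjointD b s); rewrite setUDK // => ->; rewrite eqxx.
  case=> [/andP[sX sj]|/imsetP[t]].
    split=> //; rewrite EY; case: ifP => // sab; apply: contraL ja => /subset_leq_card.
    by rewrite (eqP sj) -leqNgt.
  rewrite inE => /andP[ta /eqP tj] ->.
  have c : #|b :|: t| = j by rewrite card_disjU 1?addnC // disjoint_sym; apply: disjointWl ta dab.
  rewrite c; split=> //; rewrite EY ifT; last by rewrite subUset subsetUr (subset_trans ta) ?subsetUl.
  by apply: contraL ja => /subset_leq_card; rewrite c -leqNgt.
rewrite cardsU (_ : _ :&: _ = set0) ?cards0 ?subn0; last first.
  apply/setP=> s; rewrite !inE; apply/negP=> /andP[/andP[sX _] /imsetP[t]].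
  rewrite inE => /andP[ta _] es; move: sX; rewrite EX es ?subsetUl //.
  by rewrite subUset subsetUr (subset_trans ta) ?subsetUl.
congr (_ + _)%N; rewrite card_in_imset; last first.
  move=> t t'; rewrite !inE => /andP[ta _] /andP[ta' _] e.
  have K s : s \subset a -> (b :|: s) :\: b = s.
    by move=> sa; rewrite setDUl setDv set0U; apply/setDidPl; apply: disjointWl sa dab.
  by rewrite -(K _ ta) e K.
have [bj|jb] := leqP #|b| j.
  rewrite mul1n -cards_draws; apply: eq_card => t; rewrite !inE; congr (_ && _).
  by rewrite -[in LHS](subnK bj) eqn_add2r.
rewrite mul0n; apply/eqP; rewrite cards_eq0 -subset0; apply/subsetP=> t; rewrite !inE.
by case/andP=> _ /eqP e; move: jb; rewrite -e ltnNge leq_addl.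
Qed.

End VsMove.

(** Expectation of [tchi] on the part of [W] that precedes one extra element in a random ordering;
    for a link, that element is the vertex linked. *)
Definition avg k W X : rat :=
  \sum_(A : face | A \subset W) wt #|A| (#|W| - #|A|) * (tchi F k (ind X A))%:~R.

(* G i is the number of moves of index i - 1, with the initial sphere counted
   as the unique move with i = 0. *)
Lemma stell_moves k d X : (0 < k)%N -> (k.*2 <= d)%N -> stell k d X -> exists G,
  [/\ G 0%N = 1%N,
      forall j, (j <= k)%N ->
        #|[set s in X | #|s| == j]| = (\sum_(i < j.+1) G i * 'C(d.+2 - i, j - i))%N
    & forall W, vs X \subset W ->
        avg k W X = \sum_(i < k.+1) (-1) ^+ i * (G i)%:R * wt i (d.+2 - i)].
Proof.
move=> k0 kd; elim=> {X} [a ca|X Y a b sX [G [G0 fX aX]] mv bk].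
  exists (fun i => nat_of_bool (i == 0%N)); split=> [//|j jk|W aW].
    rewrite big_ord_recl /= mul1n !subn0 big1 ?addn0; last by move=> i _; rewrite mul0n.
    rewrite -ca -cards_draws; apply: eq_card => s; rewrite !inE properEcard.
    case: eqP => [->|]; rewrite ?andbF // !andbT.
    by rewrite (_ : (j < #|a|)%N) ?andbT // ca; lia.
  have a1 : (1 < #|a|)%N by rewrite ca.
  rewrite big_ord_recl big1 => [|i _]; last by rewrite /= mulr0 mul0r.
  rewrite vs_sphere // in aW; rewrite expr0 !mul1r addr0 subn0 -ca.
  (* On the initial sphere [tchi] is 1 if [A] misses [a] and 0 otherwise, as the truncation stays
     below the top degree. *)
  have := avg_trace aW (sub0set a); rewrite cards0 subn0 => <-.
  apply: eq_bigr => A _; congr (_ * _).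
  rewrite /tchi big_ord_recl big1 => [|i _]; last first.
    by rewrite hd_ind_sphere ?mulr0 // ca /= /bump /=; have := ltn_ord i; lia.
  by rewrite expr0 mul1r addr0 hd0_ind_sphere // natz pmulrn.
have hX := stell_HS F sX; have [[a0 b0 dab] cab _ _] := mv.
have b_gt0 : (0 < #|b|)%N by rewrite card_gt0.
have ak : (k.+1 < #|a|)%N by lia.
have a1 : (1 < #|a|)%N by lia.
exists (fun i => G i + (i == #|b|))%N; split=> [|j jk|W YW].
- by rewrite G0 (ltn_eqF b_gt0).
- rewrite (smove_count mv) ?fX //; last by apply: leq_ltn_trans jk _; apply: ltnW.
  under [RHS]eq_bigr => i _ do rewrite mulnDl.
  rewrite big_split /=; congr (_ + _)%N.
  have [bj|jb] := leqP #|b| j; last first.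
    rewrite big1 // => i _; case: eqP => // e; move: (ltn_ord i); rewrite e ltnS leqNgt jb //.
  have bj' : (#|b| < j.+1)%N by [].
  rewrite (bigD1 (Ordinal bj')) //= eqxx !mul1n big1 ?addn0; last first.
    by move=> i ib; rewrite (_ : _ == _ = false) //; apply/negbTE; move: ib; rewrite -val_eqE.
  by congr (binomial _ _); rewrite -cab addnK.
(* Since [1 < #|a|], such a move deletes no vertex, so one [W] serves all earlier complexes. *)
have XW : vs X \subset W by apply: subset_trans YW; apply: smove_vsX mv a1.
have abW : a :|: b \subset W by apply: subset_trans YW; apply: smove_vs_ab mv a1.
under eq_bigr => i _ do rewrite natrD mulrDr mulrDl.
rewrite big_split /= -(aX W XW).
have bk' : (#|b| < k.+1)%N by [].
rewrite [X in _ = _ + X](bigD1 (Ordinal bk')) //= eqxx mulr1 [X in _ = _ + (_ + X)]big1 ?addr0; last first.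
  move=> i ib; rewrite (_ : _ == _ = false) ?mulr0 ?mul0r //.
  by apply/negbTE; move: ib; rewrite -val_eqE.
have cab' : #|a :|: b| = d.+2 by rewrite card_disjU.
rewrite -cab' -(avg_trace abW (subsetUr a b)) mulr_sumr /avg -big_split /=.
apply: eq_bigr => A _; rewrite (move_tchi hX mv) // intrD mulrDr; congr (_ + _).
rewrite intrM !rmorphXn /= rmorphN1 rmorph_nat; ring.
Qed.

Lemma face_count k X j : iscplx X -> nb k X -> (j <= k)%N ->
  #|[set s in X | #|s| == j]| = 'C(#|vs X|, j).
Proof.
move=> cX nX jk; rewrite -cards_draws; apply: eq_card => s; rewrite !inE.
case: eqP => [e|]; rewrite ?andbF // !andbT; apply/idP/idP => [|sX]; first exact: face_vs.
by apply: nX; rewrite ?e.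
Qed.

(** Neighbourliness fixes the numbers of faces with at most [k] elements, and these determine [G]
    through a triangular system with unit diagonal, whose solution is given by
    [multiset_vandermonde]. *)
Lemma stell_nb_moves k d X : (0 < k)%N -> (k.*2 <= d)%N -> stell k d X -> nb k X ->
  (d.+2 <= #|vs X|)%N /\ forall W, vs X \subset W ->
    avg k W X = \sum_(i < k.+1) (-1) ^+ i * 'C((#|vs X| - d.+2 + i).-1, i)%:R * wt i (d.+2 - i).
Proof.
move=> k0 kd sX nX; have [cX _] := stell_HS F sX.
have [G [G0 f a]] := stell_moves k0 kd sX.
have e j : (j <= k)%N -> (\sum_(i < j.+1) G i * 'C(d.+2 - i, j - i))%N = 'C(#|vs X|, j).
  by move=> jk; rewrite -f // (face_count cX nX).
have le : (d.+2 <= #|vs X|)%N.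
  (* The equation for vertices reads [d + 2 + G 1 = #|vs X|]. *)
  have := e 1%N k0; rewrite !big_ord_recl big_ord0 /= G0 /= !subn0 !bin1 => <-.
  by rewrite mul1n leq_addr.
split=> // W XW; rewrite a //; apply: eq_bigr => -[i ik] _ /=; congr (_ * _%:R * _).
set t := (#|vs X| - d.+2)%N.
have vX : #|vs X| = (t + d.+2)%N by rewrite subnK.
elim/ltn_ind: i ik => j IH; rewrite ltnS => jk.
have := e j jk; rewrite vX -multiset_vandermonde; last by lia.
rewrite !big_ord_recr /= !subnn !bin0 !muln1.
rewrite (eq_bigr (fun i : 'I_j => 'C((t + i).-1, i) * 'C(d.+2 - i, j - i))%N) => [/addnI //|i _].
by rewrite IH // ltnS (leq_trans (ltnW (ltn_ord i))).
Qed.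

End MoveCount.

(** * The critical Betti number when d = 2k + 1 *)

Section CriticalBetti.
Local Open Scope ring_scope.
Variables (F : fieldType) (N : nat).
Local Notation face := {set 'I_N}.
Local Notation chn := {ffun {set 'I_N} -> F^o}.
Local Notation C := (C F).
Local Notation Z := (Z F).
Local Notation B := (B F).
Local Notation hd := (hd F).
Local Notation D := (D F N).
Local Notation Inj := (Inj F).
Implicit Types (u v w x y : 'I_N) (s t a b A W : face) (c z : chn).
Implicit Types (i j k : nat) (X Y K L M : {set face}).
Variables (k : nat) (M : {set face}).
Let e := k.*2.
Hypotheses (cM : iscplx M) (k2 : (1 < k)%N).
Hypothesis (lkM : forall x, x \in vs M -> stell k e (lk M [set x])).
Hypothesis (nbM : nb k.+1 M).
Hypothesis (M0 : vs M != set0).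

Let m := #|vs M|.-1.
Let mE : #|vs M| = m.+1. Proof. by rewrite prednK // card_gt0. Qed.
Let k0 : (0 < k)%N. Proof. exact: ltnW. Qed.

Lemma tchi_nb K A : iscplx K -> nb k K -> A \subset vs K ->
  tchi F k (ind K A) = (A == set0)%:R + (-1) ^+ k * (hd k (ind K A))%:Z.
Proof.
move=> cK nK AK; have [->|A0] := eqVneq A set0.
  rewrite /tchi big_ord_recl big1 => [|i _]; last by rewrite hd_ind0 ?mulr0.
  by rewrite !hd_ind0 // (gtn_eqF k0) mulr0 !addr0 expr0 mul1r.
rewrite /tchi big_ord_recr /= big1 => [|i _]; last by rewrite (nb_hd0 _ cK nK) ?mulr0.
by rewrite add0r.
Qed.

Lemma mf_link_avg x : x \in vs M -> (e.+2 <= m)%N /\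
  \sum_(A : face | A \subset vs M :\ x) wt #|A| (m - #|A|) * (hd k (ind (lk M [set x]) A))%:R
  = (-1) ^+ k * (\sum_(i < k.+1) (-1) ^+ i * 'C((m - e.+2 + i).-1, i)%:R * wt i (e.+2 - i)
                 - m.+1%:R^-1).
Proof.
move=> xM; have xM' : [set x] \in M by rewrite inE in xM.
have nL : nb k (lk M [set x]) by apply: nb_lk.
have vL : vs (lk M [set x]) = vs M :\ x by apply: vs_lk => //; apply: nbW nbM _.
have cvL : #|vs M :\ x| = m by move: mE; rewrite (cardsD1 x) xM => -[].
have [cL _] := stell_HS F (lkM xM).
have [le avgE] := stell_nb_moves F k0 (leqnn _) (lkM xM) nL.
rewrite vL cvL in le avgE; split=> //.
rewrite -(avgE _ (subxx _)) /avg cvL.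
(* The empty set contributes 1 to [tchi] but nothing in degree [k]; its weight [wt 0 m] is the
   probability that [x] comes first. *)
have -> : m.+1%:R^-1 = \sum_(A : face | A \subset vs M :\ x) wt #|A| (m - #|A|) * (A == set0)%:R.
  have := avg_trace (subxx (vs M :\ x)) (sub0set _); rewrite cvL cards0 subn0.
  rewrite {2}/wt fact0 mul1n add0n factS natrM invfM mulrC mulfVK ?fact_neq0 // => <-.
  by apply: eq_bigr => A AM; rewrite (setIidPl AM).
rewrite -sumrB mulr_sumr; apply: eq_bigr => A AM.
rewrite tchi_nb ?vL // intrD intrM rmorphXn /= rmorphN1 rmorph_nat -pmulrn.
rewrite -mulrBr addrAC subrr add0r mulrCA mulrA -mulrA; congr (_ * _).
by rewrite mulrA -expr2 sqrr_sign mul1r.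
Qed.

Let n := #|vs M|.

Lemma mf_mu :
  \sum_(x in vs M) \sum_(A : face | A \subset vs M :\ x)
     wt #|A| (m - #|A|) * (hd k (ind (lk M [set x]) A))%:R
  = 'C(n - k - 3, k.+1)%:R / 'C(2 * k + 3, k.+1)%:R.
Proof.
have [x xM] := set0Pn _ M0; have [le _] := mf_link_avg xM.
rewrite (eq_bigr _ (fun x xM => (mf_link_avg xM).2)) sumr_const -/n /n mE -[_ *+ m.+1]mulr_natl.
(* With [d := e + 2] and [j := k + 1] in [alternating_wt_sum], [d + 1 + t] is the number of vertices
   of M, [d + 1 = 2k + 3] and [t + k = n - k - 3]. *)
set t := (m - e.+2)%N; have tm : m.+1 = (e.+3 + t)%N by rewrite /t; lia.
have := @alternating_wt_sum t e.+2 k.+1; rewrite -tm; set S := \sum_(i < _) _.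
have ke : (k < e.+3)%N by rewrite /e; lia.
move=> /(_ ke) E.
have -> : m.+1%:R * ((-1) ^+ k * (S - m.+1%:R^-1)) = (-1) ^+ k.+1 * (1 - m.+1%:R * S).
  rewrite exprS mulrCA mulrBr divff ?pnatr_eq0 //; ring.
rewrite E !mulrA -expr2 sqrr_sign mul1r addnS /=.
have -> : (m.+1 - k - 3)%N = (t + k)%N by rewrite tm /e; lia.
have -> : (2 * k + 3)%N = e.+3 by rewrite /e; lia.
rewrite -mulrA; congr (_ * _); rewrite -(bin_fact ke).
have : (k.+1`! * (e.+3 - k.+1)`!)%:R != 0 :> rat.
  by rewrite pnatr_eq0 -lt0n muln_gt0 !fact_gt0.
move: (k.+1`! * _)%N => f f0; rewrite natrM invfM mulrCA divff ?mulr1 //.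
Qed.

Lemma mf_critical :
  ((hd k.+1 M)%:R = 'C(n - k - 3, k.+1)%:R / 'C(2 * k + 3, k.+1)%:R :> rat) <->
  (forall A x, x \in vs M -> A \subset vs M :\ x -> killed F k.+1 (ind M A) (ind M (x |: A)) = 0%N).
Proof.
pose r x A : rat := wt #|A| (m - #|A|) * (killed F k.+1 (ind M A) (ind M (x |: A)))%:R.
have r0 x A : 0 <= r x A by rewrite mulr_ge0 ?ler0n // ltW ?wt_gt0.
have E : (hd k.+1 M)%:R + \sum_(x in vs M) \sum_(A : face | A \subset vs M :\ x) r x A =
    'C(n - k - 3, k.+1)%:R / 'C(2 * k + 3, k.+1)%:R :> rat.
  have := telescope_orders (fun A => (hd k.+1 (ind M A))%:R) M0.
  rewrite hd_ind0 // subr0 ind_vs // => <-; rewrite -mf_mu -big_split; apply: eq_bigr => x xM /=.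
  rewrite -big_split; apply: eq_bigr => A; rewrite subsetD1 => /andP[AM xA] /=.
  rewrite -mulrDr; congr (_ * _).
  have := @mf_critical_hd F N k M cM k2 nbM A x AM xM xA.
  by move/(congr1 (fun i => i%:R : rat)); rewrite !natrD => H; rewrite addrAC H addrAC subrr add0r.
rewrite -E; split=> [/eqP|H].
  rewrite -[X in X == _]addr0 (inj_eq (addrI _)) eq_sym => /eqP S0 A x xM AM.
  have S1 : \sum_(A : face | A \subset vs M :\ x) r x A = 0.
    apply: (psumr_eq0P _ S0) xM => y _; exact: sumr_ge0.
  have /eqP := psumr_eq0P (fun A _ => r0 x A) S1 AM.
  by rewrite mulf_eq0 gt_eqF ?wt_gt0 //= pnatr_eq0 => /eqP.
rewrite big1 ?addr0 // => x xM; rewrite big1 // => A AM.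
by rewrite /r H ?mulr0.
Qed.

End CriticalBetti.

(** * Passage from complexes on nat to complexes on a bounded vertex set *)

Section FsetTransfer.
Local Open Scope fset_scope.
Variable N : nat.
Local Notation face := {set 'I_N}.
Implicit Types (s t : face) (u a b : {fset nat}) (X Y : cplx).

Definition fs s : {fset nat} := [fset nat_of_ord i | i in s].
Definition pf u : face := [set i : 'I_N | nat_of_ord i \in u].
(** Faces with a vertex at or above [N] are lost, hence the recurring hypothesis [below]. *)
Definition cv X : {set face} := [set s : face | fs s \in X].
Definition below u := forall x, x \in u -> x < N.

Lemma in_fs (i : 'I_N) s : (nat_of_ord i \in fs s) = (i \in s).
Proof.
apply/imfsetP/idP => /= [[j js /val_inj -> //]|iS]; by exists i.
Qed.

Lemma fs_below s : below (fs s).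
Proof. by move=> x /imfsetP[i _ ->]. Qed.

Lemma in_pf (i : 'I_N) u : (i \in pf u) = (nat_of_ord i \in u).
Proof. by rewrite inE. Qed.

Lemma fsK s : pf (fs s) = s.
Proof. by apply/setP=> i; rewrite in_pf in_fs. Qed.

Lemma pfK u : below u -> fs (pf u) = u.
Proof.
move=> ub; apply/fsetP=> x; apply/idP/idP => [/[dup] /fs_below xN|xu].
  by rewrite -[x]/(nat_of_ord (Ordinal xN)) in_fs in_pf.
by rewrite -[x]/(nat_of_ord (Ordinal (ub x xu))) in_fs in_pf.
Qed.

Lemma fs_inj : injective fs.
Proof. exact: can_inj fsK. Qed.

Lemma fs_subset s t : (fs s `<=` fs t) = (s \subset t).
Proof.
apply/fsubsetP/subsetP => [H i|H x]; first by rewrite -!in_fs => /H.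
by move=> /[dup] /fs_below xN; rewrite -[x]/(nat_of_ord (Ordinal xN)) !in_fs => /H.
Qed.

Lemma card_fs s : #|` fs s| = #|s|.
Proof. by rewrite card_imfset //=; [rewrite -cardE|exact: val_inj]. Qed.

Lemma card_pf u : below u -> #|pf u| = #|` u|.
Proof. by move=> ub; rewrite -card_fs pfK. Qed.

Lemma fs0 : fs set0 = fset0.
Proof. by apply/eqP; rewrite -cardfs_eq0 card_fs cards0. Qed.

Lemma fsU s t : fs (s :|: t) = fs s `|` fs t.
Proof.
apply/fsetP=> x; have [xN|Nx] := ltnP x N.
  by rewrite inE -[x]/(nat_of_ord (Ordinal xN)) !in_fs inE.
have no r : (x \in fs r) = false by apply/negP=> /fs_below; rewrite ltnNge Nx.
by rewrite inE !no.
Qed.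

Lemma fs1 (i : 'I_N) : fs [set i] = [fset nat_of_ord i].
Proof.
apply/fsetP=> x; rewrite inE; apply/imfsetP/eqP => /= [[j]|->]; first by rewrite inE => /eqP->.
by exists i; rewrite ?inE.
Qed.

Lemma fsD1 s (i : 'I_N) : fs s `\ nat_of_ord i = fs (s :\ i).
Proof.
apply/fsetP=> x; have [xN|Nx] := ltnP x N.
  by rewrite !inE -[x]/(nat_of_ord (Ordinal xN)) !in_fs !inE.
have no r : (x \in fs r) = false by apply/negP=> /fs_below; rewrite ltnNge Nx.
by rewrite inE !no andbF.
Qed.

Lemma in_cv X s : (s \in cv X) = (fs s \in X).
Proof. by rewrite inE. Qed.

Lemma iscplx_cv X : is_complex X -> iscplx (cv X).
Proof.
move=> [X0 clX]; split; first by rewrite in_cv fs0.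
by move=> s t; rewrite !in_cv => sX ts; apply: clX sX _; rewrite fs_subset.
Qed.

Lemma in_join_simplex_bdry a b u : [disjoint a & b] ->
  (u \in join (simplex a) (bdry b)) = (u `<=` a `|` b) && ~~ (b `<=` u).
Proof.
move=> dab; apply/imfset2P/andP => /= [[x xa [y yb ->]]|[uab bu]].
  move: xa yb; rewrite !inE !fpowersetE => xa /andP[nyb yb]; split; first exact: fsetUSS.
  apply: contra nyb => bxy; rewrite eqEfsubset yb /=; apply/fsubsetP=> v vb.
  have := fsubsetP bxy v vb; rewrite inE => /orP[/(fsubsetP xa) va|//].
  by have := fdisjointP dab v va; rewrite vb.
exists (u `&` a); first by rewrite fpowersetE fsubsetIr.
exists (u `&` b); last by rewrite -fsetIUr; apply/esym/fsetIidPl.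
rewrite !inE fpowersetE fsubsetIr andbT; apply: contra bu => /eqP <-; exact: fsubsetIl.
Qed.

Lemma joinC X Y : join X Y = join Y X.
Proof.
by apply/fsetP=> u; apply/imfset2P/imfset2P => -[x xX [y yY ->]]; exists y => //; exists x => //; rewrite fsetUC.
Qed.

Lemma cv_bdry a : below a -> cv (bdry a) = sphere (pf a).
Proof.
move=> ab; apply/setP=> s; rewrite in_cv in_sphere !inE fpowersetE properEneq.
by rewrite -[in LHS](pfK ab) (inj_eq fs_inj) fs_subset.
Qed.

Lemma cv_move d a b X Y : below a -> below b -> bistellar d a b X Y ->
  smove d.+1 (pf a) (pf b) (cv X) (cv Y).
Proof.
move=> ab bb [_ [a0 b0 dab] cab iX ->].
have dba : [disjoint b & a] by rewrite fdisjoint_sym.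
have ca : 0 < #|` a| by rewrite cardfs_gt0.
have cb : 0 < #|` b| by rewrite cardfs_gt0.
have EX u : u `<=` a `|` b -> (u \in X) = ~~ (b `<=` u).
  move=> uab; have := in_join_simplex_bdry u dab; rewrite -iX uab !inE /= => <-.
  by rewrite uab andbT.
have sub s : (s \subset pf a :|: pf b) = (fs s `<=` a `|` b).
  by rewrite -fs_subset fsU !pfK.
split.
- split; rewrite -?card_gt0 ?card_pf //.
  rewrite disjoints_subset; apply/subsetP=> i; rewrite !inE => ia.
  exact: (fdisjointP dab).
- by rewrite !card_pf //; lia.
- by move=> s; rewrite sub in_cv => /EX ->; rewrite -fs_subset pfK.
move=> s; rewrite sub !in_cv -(fs_subset (pf a)) pfK // in_fsetU in_fsetD in_join_simplex_bdry //.
rewrite [join (bdry a) _]joinC in_join_simplex_bdry // [b `|` a]fsetUC.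
case: ifPn => sab; last by rewrite orbF.
by rewrite EX // !andTb negbK andbN.
Qed.

Lemma cv_link X (i : 'I_N) : is_complex X -> cv (link X i) = lk (cv X) [set i].
Proof.
move=> cX; apply/setP=> s; rewrite in_lk1 !in_cv !inE /= in_fs fsU fs1.
case: (boolP (nat_of_ord i |` fs s \in X)) => [iX|]; rewrite ?andbF // !andbT.
by rewrite (cX.2 _ _ iX) // fsubsetUr.
Qed.

Lemma cv_induced X u : cv (induced X u) = ind (cv X) (pf u).
Proof.
apply/setP=> s; rewrite in_ind !in_cv !inE /=; congr (_ && _).
apply/fsubsetP/subsetP => [H i iS|H x]; first by rewrite in_pf H // in_fs.
by move=> /[dup] /fs_below xN; rewrite -[x]/(nat_of_ord (Ordinal xN)) in_fs -in_pf => /H.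
Qed.

Lemma in_vertices X x : is_complex X -> (x \in vertices X) = ([fset x] \in X).
Proof.
move=> [_ clX]; apply/bigfcupP/idP => [[s sX xs]|xX].
  by move: sX; rewrite andbT => /clX; apply; rewrite fsub1set.
by exists [fset x]; rewrite ?xX ?inE.
Qed.

Lemma vs_cv X : is_complex X -> vs (cv X) = pf (vertices X).
Proof. by move=> cX; apply/setP=> i; rewrite in_pf in_vertices // inE in_cv fs1. Qed.

Lemma face_below X u : is_complex X -> below (vertices X) -> u \in X -> below u.
Proof.
move=> cX bX uX x xu; apply: bX; rewrite in_vertices //; apply: cX.2 uX _; by rewrite fsub1set.
Qed.

Lemma nb_cv k X : is_complex X -> below (vertices X) -> neighbourly k X -> nb k (cv X).
Proof.
move=> cX bX nX s; rewrite vs_cv // -fs_subset pfK // => sX sk.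
by rewrite in_cv nX ?card_fs.
Qed.

Lemma fvec0 X : is_complex X -> below (vertices X) -> fvec X 0 = #|vs (cv X)|.
Proof.
move=> cX bX; rewrite /fvec vs_cv // card_pf //.
have -> : faces X 0 = [fset [fset x] | x in vertices X].
  apply/fsetP=> s; rewrite !inE /=; apply/andP/imfsetP => [[sX /cardfs1P[x e]]|[x /= xX ->]].
    by exists x; rewrite //= in_vertices // -e.
  by rewrite cardfs1 -in_vertices.
by rewrite card_imfset //; apply: fset1_inj.
Qed.

End FsetTransfer.

Lemma fset_bound (u : {fset nat}) : exists n, forall N, n <= N -> below N u.
Proof.
exists (\max_(x <- u) x).+1 => N le x xu; apply: leq_trans le; rewrite ltnS.
have := @leq_bigmax_seq _ (enum_fset u) xpredT id x; exact.
Qed.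

(** Intermediate complexes may have vertices that the final one lacks, so the threshold must be
    collected along the moves. *)
Lemma stellated_stell k d (X : cplx) : stellated k d X ->
  exists n, forall N, n <= N -> stell k d (cv N X).
Proof.
elim=> {X} [a ca|X Y a b _ [n H] mv bk].
  have [n an] := fset_bound a; exists n => N /an aN.
  by rewrite cv_bdry //; apply: stell_sphere; rewrite card_pf.
have [na Ha] := fset_bound a; have [nb' Hb] := fset_bound b.
exists (maxn n (maxn na nb')) => N; rewrite !geq_max => /and3P[/H sX /Ha aN /Hb bN].
apply: (stell_move sX (cv_move aN bN mv)); rewrite card_pf //.
by case: mv => _ [_ + _] _ _ _; rewrite -cardfs_gt0; lia.
Qed.

Lemma uniform_bound (P : nat -> nat -> Prop) (s : seq nat) :
  (forall x, x \in s -> exists n, forall N, n <= N -> P x N) ->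
  exists n, forall N, n <= N -> forall x, x \in s -> P x N.
Proof.
elim: s => [|x s IH] H; first by exists 0.
have [|n Hn] := IH _; first by move=> y ys; apply: H; rewrite inE ys orbT.
have [|m Hm] := H x; first by rewrite inE eqxx.
exists (maxn n m) => N; rewrite geq_max => /andP[/Hn Hs /Hm Hx] y.
by rewrite inE => /predU1P[->//|/Hs].
Qed.

(** * Comparison of the two models of homology *)

Section HomologyTransfer.
Local Open Scope ring_scope.
Variables (F : fieldType) (N : nat).
Local Notation face := {set 'I_N}.
Local Notation chn := {ffun {set 'I_N} -> F^o}.
Local Notation C := (C F).
Local Notation Z := (Z F).
Local Notation B := (B F).
Local Notation hd := (hd F).
Local Notation D := (D F N).
Local Notation Inj := (Inj F).
Local Notation cv := (cv N).
Implicit Types (s t : face) (X Y : cplx) (j : nat).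

Definition Phif X j (c : chain F X j) : chn :=
  [ffun s : face => \sum_(t : faces X j | fsval t == fs s) c t].

Lemma Phif_linear X j : linear (@Phif X j).
Proof.
move=> a c c'; apply/ffunP=> t; rewrite !ffunE scaler_sumr -big_split /=.
by apply: eq_bigr => s _; rewrite !ffunE.
Qed.

HB.instance Definition _ X j := GRing.isLinear.Build F (chain F X j) chn _ (@Phif X j)
  (@Phif_linear X j).

Definition Phi X j : 'Hom(chain F X j, chn) := linfun (@Phif X j).

Lemma PhiE X j (c : chain F X j) s (h : fs s \in faces X j) : Phi X j c s = c [` h]%fset.
Proof. by rewrite lfunE ffunE (big_pred1 [` h]%fset) // => t; rewrite /= eq_sym. Qed.

Lemma PhiN X j (c : chain F X j) s : fs s \notin faces X j -> Phi X j c s = 0.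
Proof.
move=> h; rewrite lfunE ffunE big1 // => t /eqP e.
by rewrite -e fsvalP in h.
Qed.

Lemma in_faces_cv X j s : (fs s \in faces X j) = (s \in cv X) && (#|s| == j.+1).
Proof. by rewrite !inE /= card_fs. Qed.

Lemma Phi_C X j c : Phi X j c \in C j.+1 (cv X).
Proof.
apply/memC=> s cs; have : fs s \in faces X j by apply: contraR cs => /PhiN->.
by rewrite in_faces_cv => /andP[-> /eqP->].
Qed.

Lemma incidence_fs s t :
  incidence F (fs s) (fs t) = \sum_(v | (v \in s) && (s :\ v == t)) sgn F v s.
Proof.
rewrite /incidence big_mkcond big_imfset /=; last by move=> v w _ _ /val_inj.
rewrite big_enum /= [RHS]big_mkcondr; apply: eq_bigr => v _.
rewrite fsD1 (inj_eq (@fs_inj N)); case: ifP => // _.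
congr (_ ^+ _); rewrite -card_fs; congr #|` _|; apply/fsetP=> x.
rewrite !inE /=; apply/andP/imfsetP => /= [[xs xv]|[w]].
  have xN := fs_below xs; exists (Ordinal xN) => //.
  by rewrite inE xv -in_fs xs.
by rewrite inE => /andP[ws wv] ->; rewrite in_fs.
Qed.

Section OneComplex.
Variable X : cplx.
Hypotheses (cX : is_complex X) (bX : below N (vertices X)).

Lemma fs_pf_face j (u : faces X j) : fs (pf N (fsval u)) = fsval u.
Proof.
apply/pfK/(face_below cX bX).
by have := fsvalP u; rewrite !inE => /andP[].
Qed.

Lemma Phi_inj j : lker (Phi X j) == 0%VS.
Proof.
apply/lker0P => c c' e; apply/ffunP=> u.
have h : fs (pf N (fsval u)) \in faces X j by rewrite fs_pf_face fsvalP.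
have -> : u = [` h]%fset by apply: val_inj; rewrite /= fs_pf_face.
by rewrite -!PhiE e.
Qed.

Lemma Phi_surj j z : z \in C j.+1 (cv X) -> exists c, z = Phi X j c.
Proof.
move=> /memC Cz; exists [ffun u : faces X j => z (pf N (fsval u))].
apply/ffunP=> s; have [h|h] := boolP (fs s \in faces X j).
  by rewrite PhiE ffunE /= fsK.
rewrite PhiN //; apply/eqP; apply: contraR h => /Cz[sX sj].
by rewrite in_faces_cv sX sj eqxx.
Qed.

Lemma sum_faces j (f : {fset nat} -> F) (c : chain F X j) :
  \sum_(u : faces X j) f (fsval u) * c u = \sum_(s : face) f (fs s) * Phi X j c s.
Proof.
under [RHS]eq_bigr => s _ do rewrite lfunE ffunE mulr_sumr.
rewrite (exchange_big_dep xpredT) //=; apply: eq_bigr => u _.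
rewrite (big_pred1 (pf N (fsval u))) ?fs_pf_face // => s /=.
by rewrite -[in LHS]fs_pf_face (inj_eq (@fs_inj N)) eq_sym.
Qed.

Lemma Phi_bd j (c : chain F X j.+1) : Phi X j (bd F X j c) = D (Phi X j.+1 c).
Proof.
have DC := D_C (iscplx_cv N cX) (Phi_C c).
apply/ffunP=> t; have [h|h] := boolP (fs t \in faces X j); last first.
  rewrite PhiN //; apply/esym/eqP; apply: contraR h => Dt.
  by move/memC/(_ _ Dt): DC => [tX tj]; rewrite in_faces_cv tX tj eqxx.
rewrite PhiE lfunE ffunE DE /= (sum_faces (fun u => incidence F u (fs t))) /=.
under [LHS]eq_bigr => s _ do rewrite incidence_fs mulr_suml.
rewrite (exchange_big_dep xpredT) //= [RHS]big_mkcond /=; apply: eq_bigr => v _.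
case: ifPn => vt.
  rewrite (big_pred1 (v |: t)) ?sgnU1id // => s.
  by apply/andP/eqP => [[vs /eqP <-]|->]; rewrite ?setD1K // !inE eqxx setU1K.
by rewrite big1 // => s /andP[vs /eqP e]; rewrite -e !inE eqxx in vt.
Qed.

Lemma boundaries_Phi j (c : chain F X j) :
  (c \in boundaries F X j) = (Phi X j c \in B j.+1 (cv X)).
Proof.
apply/memv_imgP/memB => [[w _ ->]|[w /Phi_surj[w' ->]]].
  by exists (Phi X j.+1 w); rewrite ?Phi_C ?Phi_bd.
rewrite -Phi_bd => /(lker0P (Phi_inj j)) ->; exists w' => //; exact: memvf.
Qed.

Lemma cycles_Phi j (c : chain F X j.+1) :
  (c \in cycles F X j.+1) = (Phi X j.+1 c \in Z j.+2 (cv X)).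
Proof.
rewrite memv_ker memZ Phi_C -Phi_bd /=; apply/eqP/eqP => [->|]; first by rewrite linear0.
by rewrite -[in X in _ = X](linear0 (Phi X j)) => /(lker0P (Phi_inj j)).
Qed.

Lemma boundaries_sub_cycles j : (boundaries F X j <= cycles F X j)%VS.
Proof.
case: j => [|j]; first exact: subvf.
apply/subvP=> c; rewrite boundaries_Phi cycles_Phi; apply/subvP/subBZ.
exact: iscplx_cv.
Qed.

(** Stated from dimension 1 on, because in dimension 0 [betti] is unreduced while [hd] is
    reduced. *)
Lemma betti_hd j : betti F X j.+1 = hd j.+2 (cv X).
Proof.
have dimPhi i (U : {vspace chain F X i}) : \dim (Phi X i @: U)%VS = \dim U.
  by apply: limg_dim_eq; move: (Phi_inj i) => /eqP->; rewrite capv0.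
have eB : (Phi X j.+1 @: boundaries F X j.+1)%VS = B j.+2 (cv X).
  apply/vspaceP=> z; apply/memv_imgP/idP => [[c + ->]|Bz]; first by rewrite boundaries_Phi.
  have [c ec] : exists c, z = Phi X j.+1 c.
    apply: Phi_surj; have := subvP (subBZ F _ (iscplx_cv N cX)) _ Bz.
    by rewrite memZ => /andP[].
  by exists c; rewrite ?boundaries_Phi -?ec.
have eZ : (Phi X j.+1 @: cycles F X j.+1)%VS = Z j.+2 (cv X).
  apply/vspaceP=> z; apply/memv_imgP/idP => [[c + ->]|Zz]; first by rewrite cycles_Phi.
  have [c ec] : exists c, z = Phi X j.+1 c.
    by apply: Phi_surj; move: Zz; rewrite memZ => /andP[].
  by exists c; rewrite ?cycles_Phi -?ec.
rewrite /hd -eB -eZ !dimPhi -(dimv_cap_compl (cycles F X j.+1) (boundaries F X j.+1)).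
rewrite (capv_idPr (boundaries_sub_cycles _)) addKn /betti dimvf.
by [].
Qed.

End OneComplex.

Lemma Phi_incl Y X j (c : chain F Y j) : (Y `<=` X)%fset ->
  Phi X j (incl_chain X c) = Phi Y j c.
Proof.
move=> YX; apply/ffunP=> s; have [h|h] := boolP (fs s \in faces X j).
  by rewrite PhiE ffunE [in RHS]lfunE ffunE.
rewrite PhiN // PhiN //; apply: contra h; rewrite !inE /= => /andP[sY ->].
by rewrite (fsubsetP YX).
Qed.

(** Dimension 0 is included: [Inj] intersects boundaries with all chains of the subcomplex, not with
    cycles, so reduced and unreduced homology give the same condition. *)
Lemma hmap_Inj Y X j : is_complex Y -> is_complex X -> (Y `<=` X)%fset ->
  below N (vertices X) ->
  injective (@hmap F Y X j) <-> Inj j.+1 (cv Y) (cv X).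
Proof.
move=> cY cX YX bX.
have bY : below N (vertices Y).
  by move=> x; rewrite in_vertices // => /(fsubsetP YX); rewrite -in_vertices //; apply: bX.
have incl_cycle z : z \in cycles F Y j -> incl_chain X z \in cycles F X j.
  case: j z => [|i] z; first by rewrite !memvf.
  by rewrite !memv_ker -incl_chain_bd // => /eqP->; rewrite linear0.
have hmap_lin (h h' : homology F Y j) : hmap X (h - h') = hmap X h - hmap X h'.
  rewrite /hmap /hclass.
  have -> : vsval (h - h') = vsval h - vsval h' by exact: linearB.
  by rewrite linearB /= linearB /= linearB.
have hmap0 : hmap X (0 : homology F Y j) = 0 by rewrite -(subrr 0) hmap_lin subrr.
split=> [inj|/subvP inj].
  apply/subvP=> z' /memv_capP[BXz' /Phi_surj[z ez]].
  have Zz : z \in cycles F Y j.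
    case: j z ez BXz' {inj incl_cycle hmap_lin hmap0} => [|i] z ez BXz'; first exact: memvf.
    rewrite (cycles_Phi cY bY) -ez memZ {1}ez Phi_C /=.
    by case/memB: BXz' => w _ ->; rewrite DD.
  rewrite ez -boundaries_Phi // -hclass_eq0 //; apply/eqP/inj.
  rewrite hmap0 hmapE //; apply/eqP; rewrite hclass_eq0 ?incl_cycle //.
  by rewrite boundaries_Phi // Phi_incl // -ez.
move=> h h' e; apply/eqP; rewrite -subr_eq0; set g := h - h'.
have g0 : hmap X g = 0 by rewrite hmap_lin e subrr.
have Zg : vsval g \in cycles F Y j by apply: (subvP (diffvSl _ _)) (subvsP g).
have Bg : vsval g \in boundaries F Y j.
  rewrite boundaries_Phi //; apply: inj; rewrite memv_cap Phi_C andbT.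
  by rewrite -(Phi_incl _ YX) -boundaries_Phi // -hclass_eq0 ?incl_cycle //; apply/eqP.
(* The representative lies in the chosen complement of the boundaries, so being a boundary makes it
   zero. *)
have : vsval g \in (boundaries F Y j :&: (cycles F Y j :\: boundaries F Y j))%VS.
  by rewrite memv_cap Bg subvsP.
by rewrite capvC capv_diff memv0.
Qed.

End HomologyTransfer.

Theorem proposition5p14 (k d : nat) (M : cplx)
    (hk : 2 <= k) (hM : classWstar k d M) :
  (d <> 2 * k + 1 -> forall F : fieldType, tight F d M) /\
  (d = 2 * k + 1 -> forall F : fieldType,
     tight F d M <->
     ((betti F M k)%:R =
        'C(fvec M 0 - k - 3, k.+1)%N%:R / 'C(2 * k + 3, k.+1)%N%:R :> rat)%R).
Proof.
case: hM => -[kd cM [dimM _] conM lkM] nM.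
have [n1 Hn1] := fset_bound (vertices M).
have [n2 Hn2] := uniform_bound (fun x (xM : x \in vertices M) => stellated_stell (lkM x xM)).
(* One bound for the vertices of M and of all complexes in the moves that build its finitely many
   links. *)
pose N := maxn n1 n2; have bM := Hn1 N (leq_maxl _ _); have sM := Hn2 N (leq_maxr _ _).
pose M' := cv N M; have cM' : iscplx M' := iscplx_cv N cM.
have [e de] : exists e, d = e.+1 by exists d.-1; lia.
subst d; rewrite /= in sM.
have dimM' (s : {set 'I_N}) : s \in M' -> #|s| <= e.+2 by rewrite in_cv => /dimM; rewrite card_fs.
have lkM' x : x \in vs M' -> stell k e (lk M' [set x]).
  by rewrite vs_cv // in_pf => /sM; rewrite -cv_link.
have nM' : nb k.+1 M' := nb_cv cM bM nM.
have M0 : vs M' != set0.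
  case: conM => /fset0Pn[x xM] _; apply/set0Pn; exists (Ordinal (bM x xM)).
  by rewrite vs_cv // in_pf.
have tightE F : tight F e.+1 M <->
    forall (A : {set 'I_N}) j, A \subset vs M' -> j <= e.+1 -> Inj F j.+1 (ind M' A) M'.
  have cI u : is_complex (induced M u).
    split; first by rewrite !inE cM.1 fsub0set.
    move=> s t; rewrite !inE /= => /andP[sM' su] ts; rewrite (cM.2 _ _ sM' ts).
    exact: fsubset_trans su.
  have subI u : (induced M u `<=` M)%fset by apply/fsubsetP=> s; rewrite !inE => /andP[].
  have E u j := hmap_Inj F j (cI u) cM (subI u) bM.
  split=> [[_ H] A j AM je|H]; [|split=> // u j uM je].
    move: AM; rewrite vs_cv // -(fs_subset A) pfK // => AM.
    by have := (E _ _).1 (H _ j AM je); rewrite cv_induced fsK.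
  apply/E; rewrite cv_induced; apply: H => //; rewrite vs_cv //.
  by apply/subsetP=> i; rewrite !in_pf; apply: (fsubsetP uM).
split=> [dk F|dk F].
  apply/tightE => A j AM je; apply: (mf_Inj F cM' hk kd dimM' lkM' nM') => //.
  by apply/negP=> /andP[/eqP/dk].
have ek : e = k.*2 by lia.
have -> : betti F M k = hd F k.+1 M' by rewrite -(prednK (ltnW hk)); apply: betti_hd.
rewrite (fvec0 cM bM) -/M'; subst e.
have mu := mf_critical F cM' hk lkM' nM' M0.
apply: (iff_trans _ (iff_sym mu)); apply: (iff_trans _ (mf_critical_Inj F k cM')).
apply: (iff_trans (tightE F)); split=> H A.
  by move=> AM; apply: H => //; lia.
(* Only [j = k] is critical; the remaining degrees are settled as in part (a). *)
move=> j AM je; have [->|jk] := eqVneq j k; first exact: H.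
have kd' : k <= k.*2.+1 by lia.
apply: (mf_Inj F cM' hk kd' dimM' lkM' nM') => //.
by rewrite negb_and eqSS jk orbT.
Qed.
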